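(* The $G$-space $\mathcal{M}$ of all $L_k^p$-maps $\Sigma \to M$ (including constant maps) is $G$-Hausdorff: any two elements of $\mathcal{M}$ not in the same $G$-orbit have disjoint $G$-invariant open neighbourhoods in $\mathcal{M}$.
   Context: $M$ is a compact $C^\infty$-manifold with a Riemannian metric. $\Sigma \simeq S^2 \simeq \mathbf{CP}^1$ with its standard complex structure and round metric. $G_0 \simeq PSL(2,\mathbf{C})$ acts on $\Sigma$ as the group of reparametrizations (Möbius transformations); $G_1$ (resp. $G_2$) is the subgroup of $G_0$ fixing one marked point $x_1$ (resp. each of two distinct marked points $x_1, x_2$) of $\Sigma$. $G$ denotes any one of the three groups $G_0, G_1, G_2$. The Sobolev order $k$ and exponent $p$ are fixed with $k - \frac{2}{p} > 1$. $\mathcal{M} = \mathcal{M}_{k,p}(\Sigma, M)$ is the space of maps $\Sigma \to M$ of Sobolev class $L_k^p$ ($k$ derivatives in $L^p$), with its $L_k^p$-topology. $G$ acts on $\mathcal{M}$ by $(g,f) \mapsto f \circ g$. *)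

(* Defs.v *)
From HB Require Import structures.
From mathcomp Require Import all_boot all_order all_algebra.
From mathcomp Require Import complex.
From mathcomp Require Import all_classical all_reals all_analysis.
From mathcomp Require Import ring.

Set Implicit Arguments.
Unset Strict Implicit.
Unset Printing Implicit Defensive.

Import Order.TTheory GRing.Theory Num.Theory numFieldNormedType.Exports.

Local Open Scope classical_set_scope.
Local Open Scope ring_scope.

(* The usual topology of the complex numbers, as for any numClosedFieldType. *)
HB.instance Definition _ (R : rcfType) := NormedModule.copy R[i] R[i]^o.

Section Smooth.
Context {R : realType}.

(* C^m on an open set U, by recursion on the directional derivatives; in finite
   dimension this is the usual notion. *)
Fixpoint Ck_on (E F : normedModType R) (m : nat) (U : set E) (f : E -> F) :
    Prop :=
  if m is m'.+1 then
    (forall x, U x -> differentiable f x) /\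
    (forall v, Ck_on m' U ('D_v f))
  else {in U, continuous f}.

Definition smooth_on (E F : normedModType R) (U : set E) (f : E -> F) : Prop :=
  forall m, Ck_on m U f.

(* A chart is a homeomorphism between an open subset of T and an open subset of
   the model space E; the values of chart_map outside chart_dom, and of
   chart_inv outside the image of chart_dom, are irrelevant. *)
Record chart (T : topologicalType) (E : normedModType R) := Chart {
  chart_dom : set T;
  chart_map :> T -> E;
  chart_inv : E -> T;
  chart_dom_open : open chart_dom;
  chart_im_open : open (chart_map @` chart_dom);
  chart_mapK : {in chart_dom, cancel chart_map chart_inv};
  chart_map_continuous : {in chart_dom, continuous chart_map};
  chart_inv_continuous : {in chart_map @` chart_dom, continuous chart_inv} }.

Definition compatible (T : topologicalType) (E : normedModType R)
    (phi psi : chart T E) : Prop :=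
  smooth_on (phi @` (chart_dom phi `&` chart_dom psi)) (psi \o chart_inv phi) /\
  smooth_on (psi @` (chart_dom phi `&` chart_dom psi)) (phi \o chart_inv psi).

Definition smooth_atlas (T : topologicalType) (E : normedModType R)
    (A : set (chart T E)) : Prop :=
  (forall x, exists2 phi, A phi & chart_dom phi x) /\
  (forall phi psi, A phi -> A psi -> compatible phi psi).

Definition max_atlas (T : topologicalType) (E : normedModType R)
    (A : set (chart T E)) : set (chart T E) :=
  [set phi | forall psi, A psi -> compatible phi psi].

Definition smooth_manifold (T : topologicalType) (E : normedModType R)
    (A : set (chart T E)) : Prop :=
  [/\ hausdorff_space T, @second_countable T & smooth_atlas A].

(* metric_at phi x v w is the inner product of the tangent vectors at the point
   of coordinates x whose components in the chart phi are v and w. *)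
Record riemannian_metric (T : topologicalType) (E : normedModType R)
    (A : set (chart T E)) := RiemannianMetric {
  metric_at : chart T E -> E -> E -> E -> R;
  metric_linear : forall phi x, A phi -> (phi @` chart_dom phi) x ->
    forall (a : R) v v' w, metric_at phi x (a *: v + v') w =
      a * metric_at phi x v w + metric_at phi x v' w;
  metric_sym : forall phi x, A phi -> (phi @` chart_dom phi) x ->
    forall v w, metric_at phi x v w = metric_at phi x w v;
  metric_pos : forall phi x, A phi -> (phi @` chart_dom phi) x ->
    forall v, v != 0 -> 0 < metric_at phi x v v;
  metric_smooth : forall phi, A phi ->
    forall v w, smooth_on (phi @` chart_dom phi)
      (fun x => metric_at phi x v w : R);
  metric_change : forall phi psi, A phi -> A psi ->
    forall x, (phi @` (chart_dom phi `&` chart_dom psi)) x ->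
    forall v w, metric_at phi x v w =
      metric_at psi (psi (chart_inv phi x))
        ('d (psi \o chart_inv phi) x v) ('d (psi \o chart_inv phi) x w) }.

(* Precomposition of a chart with a homeomorphism h of inverse h'. *)
Section PrecompChart.
Context (T : topologicalType) (E : normedModType R) (phi : chart T E).
Context (h h' : T -> T) (hK : cancel h h') (h'K : cancel h' h).
Context (hc : continuous h) (h'c : continuous h').

Lemma precomp_image (U : set T) : (phi \o h) @` (h @^-1` U) = phi @` U.
Proof.
apply/seteqP; split=> [_ [x Ux <-]|_ [x Ux <-]]; first by exists (h x).
by exists (h' x); rewrite /= h'K.
Qed.

Lemma precomp_dom_open : open (h @^-1` chart_dom phi).
Proof.
by apply: open_comp; [move=> x _; exact: hc|exact: chart_dom_open].
Qed.

Lemma precomp_im_open : open ((phi \o h) @` (h @^-1` chart_dom phi)).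
Proof. by rewrite precomp_image; exact: chart_im_open. Qed.

Lemma precomp_mapK :
  {in h @^-1` chart_dom phi, cancel (phi \o h) (h' \o chart_inv phi)}.
Proof.
by move=> x /set_mem hx; rewrite /= (chart_mapK (mem_set hx)) hK.
Qed.

Lemma precomp_map_continuous :
  {in h @^-1` chart_dom phi, continuous (phi \o h)}.
Proof.
move=> x /set_mem hx; apply: continuous_comp; first exact: hc.
exact: chart_map_continuous (mem_set hx).
Qed.

Lemma precomp_inv_continuous :
  {in (phi \o h) @` (h @^-1` chart_dom phi),
     continuous (h' \o chart_inv phi)}.
Proof.
rewrite precomp_image => x hx; apply: continuous_comp; last exact: h'c.
exact: chart_inv_continuous hx.
Qed.

Definition precomp_chart : chart T E :=
  Chart precomp_dom_open precomp_im_open precomp_mapK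
    precomp_map_continuous precomp_inv_continuous.

End PrecompChart.

End Smooth.

Section Sphere.
Import Normc.
Context (R : realType).
Local Notation C := (R[i]).

(* CP^1 = C u {oo}, with oo written None. *)
Definition sphere := one_point_compactification C.

Definition moebius_fun (a b c d : C) (z : sphere) : sphere :=
  if z is Some z then
    if c * z + d == 0 then None else Some ((a * z + b) / (c * z + d))
  else if c == 0 then None else Some (a / c).

(* PSL(2,C), as the set of the transformations of the sphere it induces. *)
Record moebius := Moebius {
  moebius_map :> sphere -> sphere;
  moebiusP : exists a b c d : C,
    a * d - b * c != 0 /\ moebius_map = moebius_fun a b c d }.

Lemma moebius_fun_comp (a b c d a' b' c' d' : C) :
  a * d - b * c != 0 -> a' * d' - b' * c' != 0 ->
  moebius_fun a b c d \o moebius_fun a' b' c' d' =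
  moebius_fun (a * a' + b * c') (a * b' + b * d')
              (c * a' + d * c') (c * b' + d * d').
Proof.
move=> D D'; apply/funext => -[z|] /=.
- have -> : (c * a' + d * c') * z + (c * b' + d * d') =
    c * (a' * z + b') + d * (c' * z + d') by ring.
  have -> : (a * a' + b * c') * z + (a * b' + b * d') =
    a * (a' * z + b') + b * (c' * z + d') by ring.
  case: (eqVneq (c' * z + d') 0) => [w0|w0] /=.
    have n0 : a' * z + b' != 0.
      apply: contra_neq D' => n0.
      have [c0|c0] := eqVneq c' 0.
        by move: w0; rewrite c0 mul0r add0r => ->; rewrite mulr0 mulr0 subrr.
      apply: (mulfI c0); rewrite mulr0.
      have -> : c' * (a' * d' - b' * c') =
        a' * c' * (c' * z + d') - c' * c' * (a' * z + b') by ring.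
      by rewrite w0 n0 !mulr0 subrr.
    rewrite w0 !mulr0 !addr0 mulf_eq0 (negbTE n0) orbF.
    by case: ifP => // /negbT c0; congr Some; field; rewrite c0 n0.
  have -> : (c * ((a' * z + b') / (c' * z + d')) + d == 0) =
    (c * (a' * z + b') + d * (c' * z + d') == 0).
    rewrite -[RHS](mulrI_eq0 _ (mulfI (invr_neq0 w0))).
    by congr (_ == 0); field.
  case: ifP => // /negbT n0; congr Some; field; rewrite w0 /= n0 //=.
- case: (eqVneq c' 0) => [c0|c0] /=.
    move: D'; rewrite c0 mulr0 subr0 mulf_eq0 negb_or => /andP[a0 d0].
    rewrite !mulr0 !addr0 mulf_eq0 (negbTE a0) orbF.
    by case: ifP => // /negbT cn0; congr Some; field; rewrite cn0 a0.
  have -> : (c * (a' / c') + d == 0) = (c * a' + d * c' == 0).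
    rewrite -[RHS](mulrI_eq0 _ (mulfI (invr_neq0 c0))).
    by congr (_ == 0); field.
  case: ifP => // /negbT n0; congr Some; field; rewrite c0 /= n0 //=.
Qed.

Lemma moebius_fun_scalar (a : C) : a != 0 -> moebius_fun a 0 0 a =1 id.
Proof.
move=> a0 [z|] /=; last by rewrite eqxx.
by rewrite mul0r add0r (negbTE a0) addr0 mulrAC divff // mul1r.
Qed.

Local Notation Rec := (@complex.Re R).
Local Notation Imc := (@complex.Im R).

Lemma normcR (z : C) : `|z| = (normc z)%:C%C.
Proof. by case: z. Qed.

Lemma normc_ge_parts (z : C) : `|Rec z| <= normc z /\ `|Imc z| <= normc z.
Proof.
case: z => x y /=; split; rewrite -sqrtr_sqr ler_wsqrtr //.
- by rewrite lerDl sqr_ge0.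
- by rewrite lerDr sqr_ge0.
Qed.

Lemma complex_to_real_continuous (f : C -> R) :
  (forall z w, `|f z - f w| <= normc (z - w)) -> continuous f.
Proof.
move=> lip z.
apply: (@cvgrPdist_lt _ _ _ _ (nbhs_filter z) f (f z)).2 => e e0.
have e0' : 0 < e%:C%C :> C by rewrite (ltcR 0).
have zz : (id : C -> C) @ z --> z by exact: cvg_id.
near=> w; apply: le_lt_trans (lip _ _) _.
rewrite -ltcR -normcR; near: w.
exact: (@cvgr_dist_lt _ _ _ _ _ _ _ zz _ e0').
Unshelve. all: by end_near. Qed.

Lemma Rec_continuous : continuous Rec.
Proof.
apply: complex_to_real_continuous => z w.
by have [] := normc_ge_parts (z - w); case: z w => [? ?] [? ?].
Qed.

Lemma Imc_continuous : continuous Imc.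
Proof.
apply: complex_to_real_continuous => z w.
by have [] := normc_ge_parts (z - w); case: z w => [? ?] [? ?].
Qed.

Lemma normc_continuous : continuous (@normc R : C -> R).
Proof.
apply: complex_to_real_continuous => z w.
have le_sub (u v : C) : normc u - normc v <= normc (u - v).
  by rewrite lerBlDr -{1}(subrK v u) le_normcD.
by rewrite ler_norml le_sub andbT lerNl opprB -[leRHS]normcN opprB le_sub.
Qed.

Lemma complex_pair_continuous : continuous (fun x : R * R => (x.1 +i* x.2)%C).
Proof.
move=> x.
apply: (@cvgrPdist_lt _ C _ _ (nbhs_filter x) _ _).2 => e.
rewrite ltcE /= => /andP[/eqP ie e0].
have ee : e = (complex.Re e)%:C%C by case: e ie {e0} => ? ? /= ->.
have e20 : 0 < complex.Re e / 2 by rewrite divr_gt0.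
near=> y.
have [y1 y2] : `|x.1 - y.1| < complex.Re e / 2 /\
               `|x.2 - y.2| < complex.Re e / 2.
  have : `|x - y| < complex.Re e / 2.
    by near: y; exact: (@cvgr_dist_lt _ _ _ _ _ id x cvg_id _ e20).
  by rewrite prod_normE gt_max => /andP[].
rewrite ee normcR ltcR /=.
have := @le_normcD R ((x.1 - y.1) +i* 0)%C (0 +i* (x.2 - y.2))%C.
rewrite /= addr0 add0r !(expr0n, addr0, add0r) /= !sqrtr_sqr.
move=> /le_lt_trans; apply.
by rewrite [ltRHS](splitr (complex.Re e)) ltrD.
Unshelve. all: by end_near. Qed.

Lemma square_compact (r : R) :
  compact [set z : C | `|Rec z| <= r /\ `|Imc z| <= r].
Proof.
pose g (x : R * R) : C := (x.1 +i* x.2)%C.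
have gc : continuous g := complex_pair_continuous.
have -> : [set z : C | `|Rec z| <= r /\ `|Imc z| <= r] =
    g @` (`[- r, r] `*` `[- r, r]).
  apply/seteqP; split=> [[x y] /= [x0 y0]|_ [[x y] [/= x0 y0] <-] /=].
    by exists (x, y) => //; split; rewrite /= in_itv /= -ler_norml.
  by move: x0 y0; rewrite !in_itv /= -!ler_norml.
apply: continuous_compact; first exact: continuous_subspaceT.
by apply: compact_setX; exact: segment_compact.
Qed.

Local Notation inversion := (moebius_fun 0 1 1 0).

Lemma inversion_continuous_0 : {for Some 0, continuous inversion}.
Proof.
rewrite /prop_for /continuous_at /= mul1r addr0 eqxx => U [K [cK _] KU].
have : bounded_set (@normc R @` K).
  apply: compact_bounded; apply: continuous_compact => //.
  exact: continuous_subspaceT normc_continuous.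
move=> [M [_ /(_ (Num.max M 0 + 1))]].
rewrite ltr_pwDr ?ltr01 ?le_max ?lexx // => /(_ isT).
set m := Num.max M 0 + 1 => KM.
have m0 : 0 < m by rewrite ltr_pwDr // le_max lexx orbT.
suff H : \forall z \near (0 : C), U (inversion (Some z)) by exact: H.
near=> z; apply: KU => /=; rewrite mul1r addr0 mul0r add0r div1r.
case: ifP => [_|/negbT z0]; first by right.
left; exists z^-1 => // Kz.
have : normc z^-1 <= m.
  rewrite -[leLHS]ger0_norm ?sqrtr_ge0; last by case: (z^-1) => ? ?; rewrite sqrtr_ge0.
  by apply: KM; exists z^-1.
apply/negP; rewrite -ltNge normcV.
have zm : `|0 - z| < (m^-1)%:C%C.
  near: z.
  apply: (@cvgr_dist_lt _ _ _ _ (nbhs_filter (0 : C)) id 0 cvg_id).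
  by rewrite (ltcR 0) invr_gt0.
have nz : 0 < normc z by rewrite -(ltcR 0) -normcR normr_gt0.
rewrite -ltf_pV2 ?invrK ?posrE ?invr_gt0 //.
by move: zm; rewrite sub0r normrN normcR ltcR.
Unshelve. all: by end_near. Qed.

Lemma inversion_continuous_oo : {for None, continuous inversion}.
Proof.
rewrite /prop_for /continuous_at /= oner_eq0 mul0r => U.
rewrite -[nbhs _ U]/(\forall z \near (0 : C), U (Some z)).
move=> /nbhs_norm0P[e /=]; rewrite ltcE /= => /andP[/eqP ie e0] eU.
have ee : e = (complex.Re e)%:C%C by case: e ie {e0 eU} => ? ? /= ->.
set r := complex.Re e in e0 ee.
exists [set z : C | `|Rec z| <= r^-1 /\ `|Imc z| <= r^-1].
  split; first exact: square_compact.
  have hC : hausdorff_space C by exact: norm_hausdorff.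
  exact: (compact_closed hC (@square_compact r^-1)).
move=> _ [[z /= zr <-]|-> /=]; last first.
  by rewrite oner_eq0 mul0r; apply: eU; rewrite /= normr0 ltcE /= ie eqxx.
have nz : r^-1 < normc z.
  rewrite ltNge; apply/negP => zr'; apply: zr.
  by have [] := normc_ge_parts z; split; apply: le_trans zr'.
have z0 : z != 0.
  apply: contraTneq nz => ->.
  by rewrite normc0 -leNgt invr_ge0 ltW.
rewrite /= mul1r addr0 (negbTE z0) mul0r add0r div1r; apply: eU => /=.
rewrite ee normcR ltcR normcV -ltf_pV2 ?invrK ?posrE ?invr_gt0 //.
by apply: lt_trans nz; rewrite invr_gt0.
Qed.

Lemma moebius_fun_continuous_fin (a b c d z : C) : c * z + d != 0 ->
  {for Some z, continuous (moebius_fun a b c d)}.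
Proof.
move=> n0.
have aff (u v : C) : (fun w : C => u * w + v) @ z --> u * z + v.
  have fz : Filter (nbhs z) := nbhs_filter z.
  have cm : (fun w : C => u * w) @ z --> u * z.
    exact: (@cvgM _ _ _ fz _ _ _ _ (@cvg_cst C u C _ fz) cvg_id).
  exact: (@cvgD _ _ _ _ fz _ _ _ _ cm (@cvg_cst C v C _ fz)).
have den := aff c d; have num := aff a b.
have quo := @cvgM _ _ _ (nbhs_filter z) _ _ _ _ num
  (@cvgV _ _ _ (nbhs_filter z) _ _ n0 den).
rewrite /prop_for /continuous_at /= (negbTE n0) => U.
rewrite -[nbhs _ U]/(\forall w \near ((a * z + b) / (c * z + d) : C), U (Some w)).
move=> /quo HU.
suff H : \forall w \near z, U (moebius_fun a b c d (Some w)) by exact: H.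
have n0' : \forall w \near z, c * w + d != 0.
  exact: (@cvgr_neq0 _ _ _ _ (nbhs_filter z) _ _ den n0).
near=> w => /=.
have -> : (c * w + d == 0) = false by apply/negbTE; near: w.
by near: w.
Unshelve. all: by end_near. Qed.

Lemma inversion_det : 0 * 0 - 1 * 1 != 0 :> C.
Proof. by rewrite mul0r mul1r sub0r oppr_eq0 oner_neq0. Qed.

Lemma moebius_fun_continuous_some (a b c d z : C) : a * d - b * c != 0 ->
  {for Some z, continuous (moebius_fun a b c d)}.
Proof.
move=> D; have [n0|] := eqVneq (c * z + d) 0; last first.
  exact: moebius_fun_continuous_fin.
have -> : moebius_fun a b c d = inversion \o moebius_fun c d a b.
  rewrite moebius_fun_comp ?inversion_det //.
    by rewrite !mul0r !mul1r !add0r !addr0.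
  by rewrite -oppr_eq0 opprB [d * a]mulrC [c * b]mulrC.
have n1 : a * z + b != 0.
  apply: contra_neq D => n1.
  have [c0|c0] := eqVneq c 0.
    by move: n0; rewrite c0 mul0r add0r => ->; rewrite !mulr0 subrr.
  apply: (mulfI c0); rewrite mulr0.
  have -> : c * (a * d - b * c) =
    a * c * (c * z + d) - c * c * (a * z + b) by ring.
  by rewrite n0 n1 !mulr0 subrr.
apply: continuous_comp; first exact: moebius_fun_continuous_fin.
by rewrite /= (negbTE n1) n0 mul0r; exact: inversion_continuous_0.
Qed.

Lemma moebius_fun_continuous (a b c d : C) :
  a * d - b * c != 0 -> continuous (moebius_fun a b c d).
Proof.
move=> D [z|]; first exact: moebius_fun_continuous_some.
have -> : moebius_fun a b c d = moebius_fun b a d c \o inversion.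
  rewrite moebius_fun_comp ?inversion_det //.
    by rewrite !mulr0 !mulr1 !add0r !addr0.
  by rewrite -oppr_eq0 opprB.
apply: continuous_comp; first exact: inversion_continuous_oo.
rewrite /= oner_eq0 mul0r; apply: moebius_fun_continuous_some.
by rewrite -oppr_eq0 opprB.
Qed.

Lemma moebius_continuous (g : moebius) : continuous g.
Proof.
by have [a [b [c [d [D ->]]]]] := moebiusP g; exact: moebius_fun_continuous.
Qed.

Lemma moebius_compP (g h : moebius) : exists a b c d : C,
  a * d - b * c != 0 /\ g \o h = moebius_fun a b c d.
Proof.
have [a [b [c [d [D ->]]]]] := moebiusP g.
have [a' [b' [c' [d' [D' ->]]]]] := moebiusP h.
exists (a * a' + b * c'), (a * b' + b * d'), (c * a' + d * c'), (c * b' + d * d').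
split; last exact: moebius_fun_comp.
suff -> : (a * a' + b * c') * (c * b' + d * d') -
  (a * b' + b * d') * (c * a' + d * c') =
  (a * d - b * c) * (a' * d' - b' * c') by rewrite mulf_neq0.
by ring.
Qed.

Definition moebius_comp (g h : moebius) : moebius := Moebius (moebius_compP g h).

Lemma moebius_inv_ex (g : moebius) :
  exists h : moebius, cancel g h /\ cancel h g.
Proof.
have [a [b [c [d [D gE]]]]] := moebiusP g.
have D' : d * a - (- b) * (- c) != 0 by rewrite mulrNN [d * a]mulrC.
have hP : exists a' b' c' d' : C, a' * d' - b' * c' != 0 /\
    moebius_fun d (- b) (- c) a = moebius_fun a' b' c' d'.
  by exists d, (- b), (- c), a.
exists (Moebius hP); rewrite gE; split=> x /=.
- rewrite -[LHS]/((_ \o _) x) moebius_fun_comp //.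
  rewrite (_ : d * b + - b * d = 0); last by ring.
  rewrite (_ : - c * a + a * c = 0); last by ring.
  rewrite (_ : - c * b + a * d = d * a + - b * c); last by ring.
  rewrite moebius_fun_scalar //.
  by rewrite (_ : d * a + - b * c = a * d - b * c) //; ring.
- rewrite -[LHS]/((_ \o _) x) moebius_fun_comp //.
  rewrite (_ : a * - b + b * a = 0); last by ring.
  rewrite (_ : c * d + d * - c = 0); last by ring.
  rewrite (_ : c * - b + d * a = a * d + b * - c); last by ring.
  rewrite moebius_fun_scalar //.
  by rewrite (_ : a * d + b * - c = a * d - b * c) //; ring.
Qed.

Definition moebius_inv (g : moebius) : moebius := sval (cid (moebius_inv_ex g)).

Lemma moebiusK (g : moebius) : cancel g (moebius_inv g).
Proof. by rewrite /moebius_inv; case: cid => h [] . Qed.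

Lemma moebiusVK (g : moebius) : cancel (moebius_inv g) g.
Proof. by rewrite /moebius_inv; case: cid => h []. Qed.

(* The coordinate z on C, as a chart with values in R^2. *)
Definition coord_map (z : sphere) : R * R :=
  if z is Some z then (complex.Re z, complex.Im z) else 0.
Definition coord_inv (x : R * R) : sphere := Some (x.1 +i* x.2)%C.

Lemma coord_im : coord_map @` range Some = setT.
Proof.
by apply/seteqP; split=> // -[x y] _; exists (coord_inv (x, y)) => //; eexists.
Qed.

Lemma coord_dom_open : open (range Some : set sphere).
Proof. exact: one_point_compactification_open_some openT. Qed.

Lemma coord_im_open : open (coord_map @` range Some).
Proof. by rewrite coord_im; exact: openT. Qed.

Lemma coord_mapK : {in (range Some : set sphere), cancel coord_map coord_inv}.
Proof. by move=> _ /set_mem[[x y] _ <-]. Qed.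

Lemma coord_map_continuous :
  {in (range Some : set sphere), continuous coord_map}.
Proof.
move=> _ /set_mem[z _ <-] U.
have := @cvg_pair _ _ _ _ _ _ (nbhs_filter z) _ _ _ _
  (@Rec_continuous z) (@Imc_continuous z) U.
exact.
Qed.

Lemma coord_inv_continuous :
  {in coord_map @` range Some, continuous coord_inv}.
Proof. by move=> x _ U; exact: complex_pair_continuous. Qed.

Definition coord_chart : chart sphere (R * R)%type :=
  Chart coord_dom_open coord_im_open coord_mapK
    coord_map_continuous coord_inv_continuous.

(* The affine coordinate z o g; the choices g = id and g = 1/z are the two usual
   charts of CP^1. *)
Definition affine_chart (g : moebius) : chart sphere (R * R)%type :=
  precomp_chart coord_chart (moebiusK g) (moebiusVK g)
    (@moebius_continuous g) (@moebius_continuous (moebius_inv g)).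

Definition sphere_atlas : set (chart sphere (R * R)%type) := range affine_chart.

Definition moebius_precomp (psi : chart sphere (R * R)%type) (g : moebius) :=
  precomp_chart psi (moebiusK g) (moebiusVK g)
    (@moebius_continuous g) (@moebius_continuous (moebius_inv g)).

Lemma max_atlas_precomp (psi : chart sphere (R * R)%type) (g : moebius) :
  max_atlas sphere_atlas psi -> max_atlas sphere_atlas (moebius_precomp psi g).
Proof.
move=> mpsi _ [h _ <-].
pose k := moebius_comp h (moebius_inv g).
have [c1 c2] := mpsi _ (imageT affine_chart k).
have invE : moebius_inv k =1 g \o moebius_inv h.
  move=> x; rewrite -[RHS](moebiusK k) /=; congr (moebius_inv k _).
  by rewrite moebiusK moebiusVK.
have imE (T : Type) (F : sphere -> T) :
    (F \o g) @` (g @^-1` chart_dom psi `&` h @^-1` range Some) =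
    F @` (chart_dom psi `&` k @^-1` range Some).
  apply/seteqP; split=> [_ [x [/= px hx] <-]|_ [x [/= px hx] <-]].
    by exists (g x) => //; split => //=; rewrite moebiusK.
  by exists (moebius_inv g x); [split; rewrite //= moebiusVK|rewrite /= moebiusVK].
split.
- by rewrite -[smooth_on _ _]/(smooth_on ((psi \o g) @` (g @^-1` chart_dom psi
    `&` h @^-1` range Some)) _) imE.
- rewrite (_ : _ \o _ = psi \o chart_inv (affine_chart k)); last first.
    by apply/funext => x /=; rewrite invE.
  have mE : (affine_chart h : sphere -> _) = affine_chart k \o g.
    by apply/funext => x /=; rewrite moebiusK.
  by rewrite mE -[X in smooth_on X _]/((affine_chart k \o g) @`
    (g @^-1` chart_dom psi `&` h @^-1` range Some)) imE.
Qed.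

End Sphere.

Section LocalSobolev.
Context (R : realType) (k : nat) (p : R).
Local Notation plane := (R * R)%type.

Local Notation lebesgue2 := (@lebesgue_measure R \x @lebesgue_measure R)%E.

Definition pderiv (a b : nat) (h : plane -> R) : plane -> R :=
  iter a (fun u => 'D_((1, 0) : plane) u)
    (iter b (fun u => 'D_((0, 1) : plane) u) h).

Definition test_function (U : set plane) (h : plane -> R) : Prop :=
  smooth_on setT h /\
  exists K : set plane,
    [/\ compact K, K `<=` U & forall x, ~ K x -> h x = 0].

Definition Lp_loc (U : set plane) (u : plane -> R) : Prop :=
  measurable_fun U u /\
  forall K : set plane, compact K -> K `<=` U ->
    (\int[lebesgue2]_(x in K) (`|u x| `^ p)%:E < +oo)%E.

Definition weak_pderiv (U : set plane) (a b : nat) (u v : plane -> R) : Prop :=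
  forall h, test_function U h ->
    \int[lebesgue2]_(x in U) (u x * pderiv a b h x) =
    (-1) ^+ (a + b) * \int[lebesgue2]_(x in U) (v x * h x).

(* v j a b is the weak derivative of order (a, b) of the j-th component of u. *)
Definition is_weak_jet (n : nat) (U : set plane) (u : plane -> 'rV[R]_n)
    (v : 'I_n -> nat -> nat -> plane -> R) : Prop :=
  forall j, Lp_loc U (fun x => u x ord0 j) /\
    forall a b, (a + b <= k)%N ->
      Lp_loc U (v j a b) /\ weak_pderiv U a b (fun x => u x ord0 j) (v j a b).

Definition Lkp_loc (n : nat) (U : set plane) (u : plane -> 'rV[R]_n) : Prop :=
  exists v, is_weak_jet U u v.

(* The L_k^p norm of u over K, a compact subset of U, is less than e; it does
   not depend on the jet v, which is unique almost everywhere. *)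
Definition Lkp_norm_lt (n : nat) (U : set plane) (u : plane -> 'rV[R]_n)
    (K : set plane) (e : R) : Prop :=
  exists2 v, is_weak_jet U u v &
    (\sum_(j < n) \sum_(a < k.+1) \sum_(b < k.+1 | (a + b <= k)%N)
       \int[lebesgue2]_(x in K) (`|v j a b x| `^ p)%:E < (e `^ p)%:E)%E.

End LocalSobolev.

Section SobolevMaps.
Context (R : realType) (n : nat) (M : topologicalType).
Context (A : set (chart M 'rV[R]_n)) (k : nat) (p : R).
Local Notation plane := (R * R)%type.
Local Notation sphere := (sphere R).
Local Notation sphere_charts := (max_atlas (@sphere_atlas R)).

Definition local_dom (f : sphere -> M) (psi : chart sphere plane)
    (phi : chart M 'rV[R]_n) : set plane :=
  psi @` (chart_dom psi `&` f @^-1` chart_dom phi).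

Definition local_rep (f : sphere -> M) (psi : chart sphere plane)
    (phi : chart M 'rV[R]_n) : plane -> 'rV[R]_n :=
  phi \o f \o chart_inv psi.

(* When k - 2/p > 1, an L_k^p map has a continuous representative; the points of
   the mapping space are these representatives. *)
Record sobolev_map := SobolevMap {
  sobolev_fun :> sphere -> M;
  sobolev_continuous : continuous sobolev_fun;
  sobolevP : forall psi phi, sphere_charts psi -> max_atlas A phi ->
    Lkp_loc k p (local_dom sobolev_fun psi phi)
      (local_rep sobolev_fun psi phi) }.

HB.instance Definition _ := gen_eqMixin sobolev_map.
HB.instance Definition _ := gen_choiceMixin sobolev_map.

(* The L_k^p topology is generated by the following sets: the maps g with g(K)
   contained in the domain of phi whose local expression is
   e-close to that of f in L_k^p norm over psi(K). *)
Definition sobolev_nbhd (f : sobolev_map) (psi : chart sphere plane)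
    (phi : chart M 'rV[R]_n) (K : set sphere) (e : R) : set sobolev_map :=
  [set g | K `<=` g @^-1` chart_dom phi /\
    Lkp_norm_lt k p (local_dom f psi phi `&` local_dom g psi phi)
      (fun x => local_rep g psi phi x - local_rep f psi phi x) (psi @` K) e].

Definition sobolev_subbase : set (set sobolev_map) :=
  [set N | exists (f : sobolev_map) psi phi (K : set sphere) (e : R),
    [/\ sphere_charts psi, max_atlas A phi, compact K,
        K `<=` chart_dom psi & K `<=` f @^-1` chart_dom phi] /\
    0 < e /\ N = sobolev_nbhd f psi phi K e].

HB.instance Definition _ :=
  isSubBaseTopological.Build sobolev_map sobolev_subbase id.

Lemma reparam_continuous (f : sobolev_map) (g : moebius R) :
  continuous (f \o g).
Proof.
move=> x; apply: continuous_comp; first exact: moebius_continuous.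
exact: sobolev_continuous.
Qed.

Lemma reparamP (f : sobolev_map) (g : moebius R) psi phi :
  sphere_charts psi -> max_atlas A phi ->
  Lkp_loc k p (local_dom (f \o g) psi phi) (local_rep (f \o g) psi phi).
Proof.
move=> mpsi mphi; pose h := moebius_inv g.
have := sobolevP f (@max_atlas_precomp R psi h mpsi) mphi.
have hE x : moebius_inv h x = g x.
  by rewrite -[LHS](moebiusVK g) -/h moebiusVK.
rewrite (_ : local_rep f _ _ = local_rep (f \o g) psi phi); last first.
  by apply/funext => x; rewrite /local_rep /= hE.
suff -> : local_dom f (moebius_precomp psi h) phi = local_dom (f \o g) psi phi.
  by [].
apply/seteqP; split=> [_ [x [/= px fx] <-]|_ [x [/= px fx] <-]].
- by exists (h x) => //; split => //=; rewrite moebiusVK.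
- by exists (g x); [split; rewrite //= moebiusK|rewrite /= moebiusK].
Qed.

Definition reparam (g : moebius R) (f : sobolev_map) : sobolev_map :=
  SobolevMap (@reparam_continuous f g) (@reparamP f g).

Definition same_orbit (G : set (moebius R)) (f1 f2 : sobolev_map) : Prop :=
  exists2 g, G g & f2 = reparam g f1.

Definition G_invariant (G : set (moebius R)) (U : set sobolev_map) : Prop :=
  forall g f, G g -> U f -> U (reparam g f).

Definition G_hausdorff (G : set (moebius R)) : Prop :=
  forall f1 f2 : sobolev_map, ~ same_orbit G f1 f2 ->
  exists U1 U2 : set sobolev_map,
    [/\ open U1, open U2, G_invariant G U1 & G_invariant G U2] /\
    [/\ U1 f1, U2 f2 & U1 `&` U2 = set0].

End SobolevMaps.

(* The groups G_0, G_1 and G_2: no, one or two fixed marked points. *)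
Definition reparam_group (R : realType) (G : set (moebius R)) : Prop :=
  [\/ G = setT,
      exists x1 : sphere R, G = [set g | g x1 = x1] |
      exists x1 x2 : sphere R, x1 <> x2 /\
        G = [set g | g x1 = x1 /\ g x2 = x2]].

(* Main.v *)
(* For k - 2/p > 1 we have k >= 2, and a function with weak derivatives in L^1 up
   to the mixed one is bounded by their L^1 norms (W^{2,1} embeds in C^0 in the
   plane).  Hence evaluation (f, z) |-> f z is jointly continuous on the mapping
   space times the sphere, and no finer information on the L_k^p topology is
   needed.  If f1 and f2 had no disjoint invariant neighbourhoods, there would be
   h near f1 and g in G with h o g near f2.  Write g as a matrix normalized to
   have largest entry 1; by compactness the matrices accumulate at some nonzero m.
   By continuity of evaluation f2 z = f1 (m z) whenever z is not in the kernel of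
   m, and, applying the same to g^-1, whose matrix is the adjugate,
   f1 w = f2 (adj(m) w) whenever w is not in the kernel of adj(m).  If m is
   invertible this says that f1 and f2 are in the same orbit.  Otherwise m and
   adj(m) have rank one, each is constant on the sphere minus a point, so f1 and
   f2 are constant, and they are equal. *)

(* Weak derivatives are visible only through integrals against smooth compactly supported functions,
   so the embedding into C^0 has to come from a good choice of such functions. They are products of
   one-variable functions, each either the difference of a narrow step at the point and a fixed step
   further out, or the derivative of the fixed step. This is why an explicit smooth step is built
   from exp(-1/x). Evaluation must be jointly continuous because in h (m' z) the map h and the point
   m' z move together. The topology of the mapping space is handled without any countability of its
   neighbourhoods, so the matrices accumulate along a filter indexed by pairs of neighbourhoods, not
   along a sequence. Marked points survive the limit: an invertible limit of matrices whose action
   fixes x fixes x, because the complement of x is open. In the singular case the identity relates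
   the two maps, and it lies in every G. *)
Require Import Defs.
From mathcomp Require Import all_boot all_order all_algebra.
From mathcomp Require Import complex.
From mathcomp Require Import all_classical all_reals all_analysis.
From mathcomp Require Import measurable_realfun ring lra.

Set Implicit Arguments.
Unset Strict Implicit.
Unset Printing Implicit Defensive.

Import Order.TTheory GRing.Theory Num.Theory numFieldNormedType.Exports.

Local Open Scope classical_set_scope.
Local Open Scope ring_scope.

(** * Calculus of functions of class C^m *)

Section SmoothCalculus.
Context {R : realType}.
Implicit Types E F : normedModType R.

Lemma near_eq_differentiable E F (f g : E -> F) (x : E) :
  (\near x, f x = g x) -> differentiable f x -> differentiable g x.
Proof.
move=> fg df.
have fgx : f x = g x := nbhs_singleton fg.
have gx : g \o shift x = cst (g x) + 'd f x +o_ 0 id.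
  have /diff_locally := df => dfE.
  apply/eqaddoP => e e0.
  have /eqaddoP/(_ _ e0) := dfE => H.
  have H' : \forall h \near 0, f (h + x) = g (h + x).
    by move: fg; rewrite (near_shift 0 x)/=; apply: filterS => h /=; rewrite subr0.
  by apply: filterS2 H' H => h fgh; rewrite !fctE /= fgh fgx.
apply/diff_locallyP; rewrite (diff_unique _ gx); last exact: diff_continuous.
by split=> //; exact: diff_continuous.
Qed.

Lemma Ck_on_continuous E F m (U : set E) (f : E -> F) :
  Ck_on m U f -> {in U, continuous f}.
Proof.
case: m => [//|m] [df _] x /set_mem Ux.
exact: differentiable_continuous (df x Ux).
Qed.

Lemma Ck_onW E F m (U : set E) (f : E -> F) : Ck_on m.+1 U f -> Ck_on m U f.
Proof.
elim: m f => [|m IH] f Cf; first exact: Ck_on_continuous Cf.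
by case: Cf => df Df; split=> // v; exact: IH.
Qed.

(** As [U] is open, agreement on [U] is agreement near each of its points and so passes to
    derivatives. The product and quotient rules, valid only on [U], enter the recursion through this
    lemma. *)
Lemma Ck_on_eq E F m (U : set E) (f g : E -> F) : open U ->
  (forall x, U x -> f x = g x) -> Ck_on m U f -> Ck_on m U g.
Proof.
move=> oU; elim: m f g => [|m IH] f g fg Cf.
  move=> x Ux; have /set_mem Ux' := Ux.
  have fgn : \near x, f x = g x by apply: filterS fg _; exact: open_nbhs_nbhs.
  rewrite /continuous_at -fg //; apply: cvg_trans (Cf x Ux).
  exact: near_eq_cvg.
have fgn x : U x -> \near x, f x = g x.
  by move=> Ux; apply: filterS fg _; exact: open_nbhs_nbhs.
case: Cf => df Df; split=> [x Ux|v].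
  exact: near_eq_differentiable (fgn x Ux) (df x Ux).
by apply: IH (Df v) => x Ux; apply: near_eq_derive; exact: fgn.
Qed.

Lemma Ck_on_cst E F m (U : set E) (a : F) : Ck_on m U (fun=> a).
Proof.
elim: m a => [|m IH] a; first by move=> x _; exact: cvg_cst.
split=> [x _|v]; first exact: differentiable_cst.
rewrite (_ : 'D_v _ = fun=> 0) //.
by apply/funext => x; rewrite derive_cst.
Qed.

Lemma Ck_onD E F m (U : set E) (f g : E -> F) : open U ->
  Ck_on m U f -> Ck_on m U g -> Ck_on m U (fun x => f x + g x).
Proof.
move=> oU; elim: m f g => [|m IH] f g Cf Cg.
  by move=> x Ux; apply: cvgD; [exact: Cf|exact: Cg].
case: Cf => df Df; case: Cg => dg Dg; split=> [x Ux|v].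
  by apply: differentiableD; [exact: df|exact: dg].
apply: Ck_on_eq (IH _ _ (Df v) (Dg v)) => // x Ux.
by rewrite deriveD //; apply: diff_derivable; [exact: df|exact: dg].
Qed.

Lemma Ck_onM E m (U : set E) (f g : E -> R) : open U ->
  Ck_on m U f -> Ck_on m U g -> Ck_on m U (fun x => f x * g x : R).
Proof.
move=> oU; elim: m f g => [|m IH] f g Cf Cg.
  by move=> x Ux; apply: cvgM; [exact: Cf|exact: Cg].
have Cf' := Ck_onW Cf; have Cg' := Ck_onW Cg.
case: Cf => df Df; case: Cg => dg Dg; split=> [x Ux|v].
  by apply: differentiableM; [exact: df|exact: dg].
apply: (@Ck_on_eq _ _ _ _ (fun x => f x * 'D_v g x + g x * 'D_v f x)) => //.
  move=> x Ux.
  by rewrite deriveM //; apply: diff_derivable; [exact: df|exact: dg].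
by apply: Ck_onD => //; [exact: IH Cf' (Dg v)|exact: IH Cg' (Df v)].
Qed.

Lemma Ck_onN E m (U : set E) (f : E -> R) : open U ->
  Ck_on m U f -> Ck_on m U (fun x => - f x : R).
Proof.
move=> oU Cf; apply: (@Ck_on_eq _ _ _ _ (fun x => -1 * f x)) => //.
  by move=> x _; rewrite mulN1r.
by apply: Ck_onM => //; exact: Ck_on_cst.
Qed.

(** The derivative of 1/f is -(1/f)^2 times that of f, so class C^(m+1) of 1/f follows from its
    class C^m, the induction hypothesis. *)
Lemma Ck_onV E m (U : set E) (f : E -> R) : open U ->
  (forall x, U x -> f x != 0) ->
  Ck_on m U f -> Ck_on m U (fun x => (f x)^-1 : R).
Proof.
move=> oU f0; elim: m => [|m IH] Cf.
  move=> x Ux; apply: cvgV; last exact: Cf.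
  by apply: f0; exact: set_mem.
have CV := IH (Ck_onW Cf); case: Cf => df Df; split=> [x Ux|v].
  by apply: differentiableV; [exact: df|exact: f0].
apply: (@Ck_on_eq _ _ _ _ (fun x => - ((f x)^-1 * (f x)^-1) * 'D_v f x)) => //.
  move=> x Ux; rewrite deriveV ?f0 //; last exact/diff_derivable/df.
  by rewrite expr2 invfM.
apply: Ck_onM (Df v) => //; apply: Ck_onN => //; exact: Ck_onM.
Qed.

Lemma Ck_on_pair E F F' m (U : set E) (f : E -> F) (g : E -> F') : open U ->
  Ck_on m U f -> Ck_on m U g -> Ck_on m U (fun x => (f x, g x)).
Proof.
move=> oU; elim: m f g => [|m IH] f g Cf Cg.
  by move=> x Ux; apply: cvg_pair; [exact: Cf|exact: Cg].
case: Cf => df Df; case: Cg => dg Dg; split=> [x Ux|v].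
  by apply: differentiable_pair; [exact: df|exact: dg].
apply: Ck_on_eq (IH _ _ (Df v) (Dg v)) => // x Ux.
have dfx := df x Ux; have dgx := dg x Ux.
have dp := differentiable_pair dfx dgx.
by rewrite !deriveE // diff_pair.
Qed.

(** The two difference quotients coincide for every increment, so the equality holds even at points
    where the limit does not exist. *)
Lemma derive_comp_affine E E' F (L : {linear E' -> E}) (b : E) (f : E -> F)
    (v : E') :
  'D_v (fun x => f (L x + b)) = fun x => 'D_(L v) f (L x + b).
Proof.
apply/funext => x; rewrite /derive /=.
suff -> : (fun h => h^-1 *: (f (L (h *: v + x) + b) - f (L x + b))) =
  (fun h => h^-1 *: (f (h *: L v + (L x + b)) - f (L x + b))) by [].
by apply/funext => h; rewrite (linearD L) linearZ_LR addrA.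
Qed.

Lemma Ck_on_comp_affine E E' F (L : {linear E' -> E}) (b : E) m (U : set E)
    (f : E -> F) : continuous L ->
  Ck_on m U f -> Ck_on m [set x | U (L x + b)] (fun x => f (L x + b)).
Proof.
move=> cL; have cLb : continuous (fun x => L x + b).
  by move=> x; apply: cvgD; [exact: cL|exact: cvg_cst].
elim: m f => [|m IH] f Cf.
  move=> x /set_mem Ux.
  apply: (@continuous_comp _ _ _ (fun x => L x + b) f); first exact: cLb.
  by apply: Cf; exact: mem_set.
case: Cf => df Df; split=> [x Ux|v].
  apply: (@differentiable_comp _ _ _ _ (fun x => L x + b) f); last exact: df.
  apply: differentiableD; last exact: differentiable_cst.
  exact: linear_differentiable.
by rewrite derive_comp_affine; exact: IH (Df (L v)).
Qed.

Lemma Ck_on_linear E F (L : {linear E -> F}) m (U : set E) :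
  continuous L -> Ck_on m U L.
Proof.
move=> cL; case: m => [|m]; first by move=> x _; exact: cL.
split=> [x _|v]; first exact: linear_differentiable.
rewrite (_ : 'D_v L = fun=> L v); first exact: Ck_on_cst.
apply/funext => x; rewrite deriveE; last exact: linear_differentiable.
by rewrite diff_lin.
Qed.

Lemma Ck_on_fst E F m (U : set (E * F)%type) : Ck_on m U (@fst E F).
Proof.
by apply: (@Ck_on_linear _ _ (@fst E F : {linear (E * F)%type -> E})) => x;
  exact: cvg_fst.
Qed.

Lemma Ck_on_snd E F m (U : set (E * F)%type) : Ck_on m U (@snd E F).
Proof.
by apply: (@Ck_on_linear _ _ (@snd E F : {linear (E * F)%type -> F})) => x;
  exact: cvg_snd.
Qed.

End SmoothCalculus.

(** * The affine charts belong to the maximal atlas *)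

Section AffineCharts.
Context (R : realType).
Local Notation plane := (R * R)%type.
Local Notation C := R[i].

Lemma Ck_on_affine m (U : set plane) (a b c : R) : open U ->
  Ck_on m U (fun x : plane => a * x.1 + b * x.2 + c : R).
Proof.
move=> oU; have cst t : Ck_on m U (fun x : plane => t : R) by exact: Ck_on_cst.
apply: Ck_onD => //; apply: Ck_onD => //; apply: Ck_onM => //.
  exact: (@Ck_on_fst _ R R).
exact: (@Ck_on_snd _ R R).
Qed.

Lemma complex_divE (x y u v : R) : u ^+ 2 + v ^+ 2 != 0 ->
  ((x +i* y) / (u +i* v) = ((x * u + y * v) / (u ^+ 2 + v ^+ 2)) +i*
     ((y * u - x * v) / (u ^+ 2 + v ^+ 2)))%C.
Proof.
move=> n0; set n := u ^+ 2 + v ^+ 2.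
transitivity ((x * (u / n) - y * - (v / n)) +i* (x * - (v / n) + y * (u / n)))%C => //.
by congr (_ +i* _)%C; ring.
Qed.

Lemma complex_eq0 (u v : R) : ((u +i* v)%C == 0) = (u ^+ 2 + v ^+ 2 == 0).
Proof. by rewrite paddr_eq0 ?sqr_ge0 // !sqrf_eq0 eq_complex. Qed.

(** In real coordinates the map is a pair of quotients of polynomials over the common denominator
    [N], the squared modulus of c z + d. The points where both affine coordinates are finite are
    exactly those with [N] nonzero. *)
Lemma moebius_coord_smooth (h : moebius R) :
  smooth_on (@coord_map R @` (range Some `&` h @^-1` range Some))
    (@coord_map R \o h \o @coord_inv R).
Proof.
have [[a1 a2] [[b1 b2] [[c1 c2] [[d1 d2] [_ hE]]]]] := moebiusP h.
pose nr (x : plane) := a1 * x.1 + (- a2) * x.2 + b1.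
pose ni (x : plane) := a2 * x.1 + a1 * x.2 + b2.
pose dr (x : plane) := c1 * x.1 + (- c2) * x.2 + d1.
pose di (x : plane) := c2 * x.1 + c1 * x.2 + d2.
pose N (x : plane) : R := dr x * dr x + di x * di x.
have NE x : N x = dr x ^+ 2 + di x ^+ 2 by rewrite /N !expr2.
have affE (a a' b b' x y : R) : ((a +i* a') * (x +i* y) + (b +i* b') =
  (a * x + (- a') * y + b) +i* (a' * x + a * y + b'))%C.
  transitivity ((a * x - a' * y + b) +i* (a * y + a' * x + b'))%C => //.
  by congr (_ +i* _)%C; ring.
have hcE x : h (coord_inv x) = if N x == 0 then None else
    Some (((nr x * dr x + ni x * di x) / N x) +i*
          ((ni x * dr x - nr x * di x) / N x))%C.
  rewrite hE /= !affE complex_eq0 -NE; case: eqVneq => // N0.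
  by rewrite complex_divE -?NE.
have CN m (U : set plane) : open U -> Ck_on m U N.
  by move=> oU; apply: Ck_onD => //; apply: Ck_onM => //; exact: Ck_on_affine.
have -> : @coord_map R @` (range Some `&` h @^-1` range Some) = [set x | N x != 0].
  apply/seteqP; split=> [_ [x [[z _ zx] [w _ hw]] <-]|x /= Nx].
    apply/negP => Nx; move: hw.
    by rewrite -(coord_mapK (mem_set (ex_intro2 _ _ z I zx))) hcE Nx.
  exists (coord_inv x); last by case: x {Nx}.
  by split; [eexists|rewrite /= hcE (negbTE Nx); eexists].
have oD : open [set x | N x != 0].
  apply: (@open_comp plane R N [set y | y != 0]); last exact: open_neq.
  by move=> x _; have /(_ x (mem_set I)) := CN 0%N setT openT.
move=> m; apply: (@Ck_on_eq _ _ _ _ _ (fun x =>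
   ((nr x * dr x + ni x * di x) / N x, (ni x * dr x - nr x * di x) / N x))) => //.
  by move=> x /= Nx; rewrite hcE (negbTE Nx).
have CV : Ck_on m [set x | N x != 0] (fun x => (N x)^-1 : R).
  by apply: Ck_onV => //; exact: CN.
apply: Ck_on_pair => //; apply: Ck_onM => //; apply: Ck_onD => //.
- by apply: Ck_onM => //; exact: Ck_on_affine.
- by apply: Ck_onM => //; exact: Ck_on_affine.
- by apply: Ck_onM => //; exact: Ck_on_affine.
- by apply: Ck_onN => //; apply: Ck_onM => //; exact: Ck_on_affine.
Qed.

(** The transition map is the Moebius transformation h' o g'^-1 read in the standard coordinate. *)
Lemma affine_chart_compatible (g h : moebius R) :
  compatible (affine_chart g) (affine_chart h).
Proof.
have smooth (g' h' : moebius R) : smooth_on (affine_chart g' @`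
    (chart_dom (affine_chart g') `&` chart_dom (affine_chart h')))
    (affine_chart h' \o chart_inv (affine_chart g')).
  have := moebius_coord_smooth (moebius_comp h' (moebius_inv g')).
  congr (smooth_on _ _).
  apply/seteqP; split=> [_ [x [/= px hx] <-]|_ [x [/= px hx] <-]].
    by exists (moebius_inv g' x); [split|]; rewrite //= moebiusVK.
  by exists (g' x) => //; split; rewrite //= moebiusK.
split; first exact: smooth.
by rewrite setIC; exact: smooth.
Qed.

Lemma affine_chart_max (g : moebius R) :
  max_atlas (@sphere_atlas R) (affine_chart g).
Proof. by move=> _ [h _ <-]; exact: affine_chart_compatible. Qed.

End AffineCharts.

(** * A smooth step function *)

Section SmoothStep.
Context {R : realType}.

(** In one variable the derivative along [v] is [v] times the ordinary one, so a single derivative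
    controls all directions. *)
Lemma Ck_on_derive1 (m : nat) (f f' : R -> R) : (forall x : R, is_derive x (1 : R) f (f' x)) ->
  Ck_on m setT f' -> Ck_on m.+1 setT f.
Proof.
move=> df Cf'.
have dif x : differentiable f x by apply/derivable1_diffP; have [] := df x.
split=> [x _|v]; first exact: dif.
apply: (@Ck_on_eq _ _ _ _ _ (fun x => v * f' x)) => //; first exact: openT.
  move=> x _; rewrite deriveE // -[v in RHS]mulr1 -[v * 1]/(v *: 1).
  by rewrite linearZ_LR -deriveE //; have [_ ->] := df x.
by apply: Ck_onM => //; [exact: openT|exact: Ck_on_cst].
Qed.

(** For each monomial, y^i / i! is a term of the exponential series, hence at most exp y; this
    bounds y^i exp(-y) by i!. *)
Lemma poly_expRN_bounded (P : {poly R}) :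
  exists2 C, 0 <= C & forall y, 0 <= y -> `|P.[y] * expR (- y)| <= C.
Proof.
exists (\sum_(i < size P) `|P`_i| * i`!%:R).
  by apply: sumr_ge0 => i _; rewrite mulr_ge0.
move=> y y0; rewrite horner_coef normrM (ger0_norm (expR_ge0 _)).
apply: le_trans (ler_wpM2r (expR_ge0 _) (ler_norm_sum _ _ _)) _.
rewrite mulr_suml; apply: ler_sum => i _.
rewrite normrM -mulrA ler_wpM2l // ger0_norm ?exprn_ge0 //.
rewrite expRN ler_pdivrMr ?expR_gt0 //.
case: (val i) => [|j]; first by rewrite expr0 fact0 mul1r -expR0 ler_expR.
rewrite mulrC -ler_pdivrMr ?ltr0n ?fact_gt0 //.
by apply: le_trans (expR_ge1Dxn j y0); rewrite lerDr.
Qed.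

(* The derivatives of [exp (- 1 / x)], extended by [0] to [x <= 0], are all of
   this form. *)
Definition flat (P : {poly R}) (x : R) : R :=
  if x <= 0 then 0 else P.[x^-1] * expR (- x^-1).

Lemma flat_le0 P x : x <= 0 -> flat P x = 0.
Proof. by rewrite /flat => ->. Qed.

Lemma flat_gt0 P x : 0 < x -> flat P x = P.[x^-1] * expR (- x^-1).
Proof. by rewrite /flat leNgt => ->. Qed.

(** The bounded function y^2 P(y) exp(-y), taken at y = 1/x, supplies the factor x^2. Quadratic
    vanishing at 0 yields the zero derivative there in [is_derive_flat]. *)
Lemma flat_bound P : exists2 C, 0 <= C & forall x, `|flat P x| <= C * x ^+ 2.
Proof.
have [C C0 PC] := poly_expRN_bounded ('X^2 * P); exists C => // x.
have [x0|x0] := leP x 0; first by rewrite flat_le0 // normr0 mulr_ge0 ?sqr_ge0.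
rewrite flat_gt0 // -ler_pdivrMr ?exprn_gt0 //.
apply: le_trans (PC x^-1 _); last by rewrite invr_ge0 ltW.
rewrite hornerM hornerXn exprVn -mulrA [leRHS]normrM mulrC.
by rewrite [in leRHS]gtr0_norm // invr_gt0 exprn_gt0.
Qed.

(** For x > 0 the chain rule gives x^-2 (P - P')(1/x) exp(-1/x), again of the form [flat]; for x < 0
    the function is locally zero; at 0 the quadratic bound decides. The family is thus closed under
    differentiation. *)
Lemma is_derive_flat P x :
  is_derive x (1 : R) (flat P) (flat ('X^2 * (P - P^`())) x).
Proof.
have [x0|x0|->] := ltgtP x 0.
- rewrite flat_le0 ?ltW //.
  apply: (@near_eq_is_derive _ _ _ (cst 0)).
  near=> y; rewrite flat_le0 //; apply: ltW; near: y; exact: lt_nbhsl.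
- have xn0 : x != 0 by rewrite gt_eqF.
  have dV : is_derive x (1 : R) (fun y : R => y^-1) (- x ^- 2).
    split; first exact: derivableV.
    by rewrite deriveV // derive_id /GRing.scale /= mulr1.
  have dP : is_derive x (1 : R) (fun y : R => P.[y^-1])
      (P^`().[x^-1] * - x ^- 2).
    exact: (@is_derive1_comp _ (horner P) (fun y : R => y^-1)).
  have dNV : is_derive x (1 : R) (fun y : R => - y^-1) (x ^- 2).
    by have := is_deriveN dV; rewrite opprK.
  have dE : is_derive x (1 : R) (fun y : R => expR (- y^-1))
      (expR (- x^-1) * x ^- 2).
    exact: (@is_derive1_comp _ expR (fun y : R => - y^-1)).
  have H : is_derive x (1 : R) (fun y : R => P.[y^-1] * expR (- y^-1))
      (flat ('X^2 * (P - P^`())) x).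
    have := is_deriveM dP dE; rewrite flat_gt0 //.
    congr (is_derive _ _ _ _); rewrite /GRing.scale /= !hornerE exprVn /=.
    by ring.
  apply: near_eq_is_derive H.
  near=> y; rewrite flat_gt0 //; near: y; exact: lt_nbhsr.
- rewrite flat_le0 //.
  have [C C0 PC] := flat_bound P.
  have lim0 : (fun h => h^-1 *: ((flat P \o shift 0) (h *: 1) - flat P 0)) @
      0^' --> (0 : R).
    apply/cvgr0Pnorm_le => e e0; near=> h.
    rewrite (flat_le0 P (lexx 0)) subr0 /= addr0 /GRing.scale /= mulr1.
    have h0 : h != 0 by near: h; exact: nbhs_dnbhs_neq.
    rewrite normrM normfV ler_pdivrMl ?normr_gt0 //.
    apply: le_trans (PC h) _.
    rewrite -(real_normK (num_real h)) expr2 mulrA mulrC ler_wpM2l //.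
    (* The [+ 1] keeps this bound positive even when [C] is 0. *)
    have : `|h| <= e / (C + 1).
      near: h; apply: dnbhs0_le; by rewrite divr_gt0 // ltr_wpDl.
    rewrite ler_pdivlMr ?ltr_wpDl // => /(le_trans _); apply.
    by rewrite mulrC ler_wpM2l // lerDl.
  split; first by apply/cvg_ex; exists 0.
  exact: cvg_lim lim0.
Unshelve. all: by end_near. Qed.

Lemma flat_smooth P : smooth_on setT (flat P).
Proof.
move=> m; elim: m P => [|m IH] P.
  apply: Ck_onW; apply: (Ck_on_derive1 (is_derive_flat P)).
  by move=> x _; apply: differentiable_continuous; apply/derivable1_diffP;
    have [] := is_derive_flat ('X^2 * (P - P^`())) x.
exact: Ck_on_derive1 (is_derive_flat P) (IH _).
Qed.

Lemma flat1_ge0 x : 0 <= flat 1 x.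
Proof.
have [x0|x0] := leP x 0; first by rewrite flat_le0.
by rewrite flat_gt0 // hornerE mul1r expR_ge0.
Qed.

Lemma flat1_gt0 x : 0 < x -> 0 < flat 1 x.
Proof. by move=> x0; rewrite flat_gt0 // hornerE mul1r expR_gt0. Qed.

Lemma derive_flat1_ge0 x : 0 <= 'D_1 (flat 1) x.
Proof.
have [_ ->] := is_derive_flat 1 x; rewrite derivC subr0 mulr1.
have [x0|x0] := leP x 0; first by rewrite flat_le0.
by rewrite flat_gt0 // hornerXn mulr_ge0 ?expR_ge0 // exprn_ge0 // invr_ge0 ltW.
Qed.

Definition unit_step (x : R) : R := flat 1 x / (flat 1 x + flat 1 (1 - x)).

Lemma unit_step_den_gt0 x : 0 < flat 1 x + flat 1 (1 - x).
Proof.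
have [x0|x0] := leP x 0; last by rewrite ltr_pwDl ?flat1_gt0 ?flat1_ge0.
by rewrite ltr_wpDl ?flat1_ge0 // flat1_gt0 //; lra.
Qed.

Lemma flat_reflect_smooth : smooth_on setT (fun x : R => flat 1 (1 - x)).
Proof.
pose L : {linear R -> R} := *:%R (-1).
move=> m; have cL : continuous L by exact: scaler_continuous.
have := @Ck_on_comp_affine _ _ _ _ L 1 m setT _ cL (@flat_smooth 1 m).
apply: Ck_on_eq; first exact: openT.
by move=> x _; rewrite /L /= scaleN1r addrC.
Qed.

Lemma unit_step_smooth : smooth_on setT unit_step.
Proof.
move=> m; have oT := @openT R; have := flat_reflect_smooth m => H.
apply: Ck_onM => //; first exact: flat_smooth.
apply: Ck_onV => //; first by move=> x _; rewrite gt_eqF ?unit_step_den_gt0.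
by apply: Ck_onD => //; exact: flat_smooth.
Qed.

(** Writing q for [flat 1] and D for the denominator, the derivative is (q(1 - x) q'(x) + q(x) q'(1
    - x)) / D^2, a sum of nonnegative terms. The sign matters because this derivative later serves
    as a probability density. *)
Lemma derive_unit_step_ge0 x : 0 <= 'D_1 unit_step x.
Proof.
have dF y : derivable (flat 1) y 1 by have [] := is_derive_flat 1 y.
have dG : is_derive x (1 : R) (fun x : R => flat 1 (1 - x)) (- 'D_1 (flat 1) (1 - x)).
  have dB : is_derive x (1 : R) (fun x : R => 1 - x) (- 1).
    have := is_deriveB (is_derive_cst (1 : R) x (1 : R)) (is_derive_id x (1 : R)).
    by rewrite sub0r.
  rewrite -mulrN1.
  exact: (@is_derive1_comp _ (flat 1) (fun x : R => 1 - x) _ _ _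
    (derivableP (dF _)) dB).
have n0 := lt0r_neq0 (unit_step_den_gt0 x).
have dD := is_deriveD (derivableP (dF x)) dG.
pose den := fun x : R => flat 1 x + flat 1 (1 - x).
have dDe : derivable den x 1 by case: dD.
have dV : derivable (fun y : R => (den y)^-1) x 1 by exact: derivableV.
rewrite -[unit_step]/(flat 1 * (fun y : R => (den y)^-1)).
rewrite (deriveM (dF x) dV) (@deriveV _ _ den x 1 n0 dDe).
rewrite (@derive_val _ _ _ _ _ _ _ dD).
rewrite /den; set D := flat 1 x + _ in n0 *; set F' := 'D_1 _ x; set G' := 'D_1 _ (1 - x).
suff -> : flat 1 x *: (- D ^- 2 *: (F' - G')) + D^-1 *: F' =
    (flat 1 (1 - x) * F' + flat 1 x * G') / D ^+ 2 :> R.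
  by rewrite divr_ge0 ?sqr_ge0 // addr_ge0 // mulr_ge0 ?flat1_ge0 //;
    exact: derive_flat1_ge0.
by rewrite /GRing.scale /= /D; field.
Qed.

Lemma smooth_step (c e : R) : 0 < e -> exists s : R -> R,
  [/\ smooth_on setT s, forall x, 0 <= s x <= 1, forall x, x <= c -> s x = 0,
      forall x, c + e <= x -> s x = 1 & forall x, 0 <= 'D_1 s x].
Proof.
move=> e0; pose L : {linear R -> R} := *:%R e^-1.
have cL : continuous L by exact: scaler_continuous.
exists (fun x => unit_step (L x + - (e^-1 * c))).
have LE x : L x + - (e^-1 * c) = (x - c) / e.
  by rewrite /L /= /GRing.scale /= -mulrBr mulrC.
split=> [m|x|x xc|x xc|x].
- exact: (Ck_on_comp_affine (- (e^-1 * c)) cL (unit_step_smooth m)).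
- rewrite /unit_step ler_pdivlMr ?ler_pdivrMr ?unit_step_den_gt0 //.
  by rewrite mul0r mul1r flat1_ge0 lerDl flat1_ge0.
- rewrite LE /unit_step flat_le0 ?mul0r //.
  by rewrite ler_pdivrMr // mul0r subr_le0.
- rewrite LE /unit_step (@flat_le0 _ (1 - _)) ?addr0 ?divff ?gt_eqF //.
    by rewrite flat1_gt0 // divr_gt0 // subr_gt0 (lt_le_trans _ xc) // ltrDl.
  by rewrite subr_le0 ler_pdivlMr // mul1r lerBrDl.
- have du y : differentiable unit_step y.
    by have [du _] := unit_step_smooth 1; exact: du.
  rewrite (congr1 (fun f => f x) (derive_comp_affine L (- (e^-1 * c)) unit_step 1)).
  rewrite -/(e^-1 *: (1 : R)) (deriveE _ (du _)) linearZ_LR -(deriveE _ (du _)).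
  by rewrite /GRing.scale /= mulr_ge0 ?derive_unit_step_ge0 // invr_ge0 ltW.
Qed.

End SmoothStep.

(** * Tensor products of functions of one variable *)

Section Tensor.
Context {R : realType}.
Local Notation plane := (R * R)%type.

Definition tensor (a b : R -> R) (x : plane) : R := a x.1 * b x.2.

Lemma smooth_comp_fst (a : R -> R) : smooth_on setT a ->
  smooth_on setT (fun x : plane => a x.1).
Proof.
move=> Ca m; have cf : continuous (@fst R R) by move=> x; exact: cvg_fst.
have := @Ck_on_comp_affine _ _ _ _ (@fst R R : {linear plane -> R}) 0 m _ a cf (Ca m).
by apply: Ck_on_eq => [|x _]; [exact: openT|rewrite /= addr0].
Qed.

Lemma smooth_comp_snd (a : R -> R) : smooth_on setT a ->
  smooth_on setT (fun x : plane => a x.2).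
Proof.
move=> Ca m; have cf : continuous (@snd R R) by move=> x; exact: cvg_snd.
have := @Ck_on_comp_affine _ _ _ _ (@snd R R : {linear plane -> R}) 0 m _ a cf (Ca m).
by apply: Ck_on_eq => [|x _]; [exact: openT|rewrite /= addr0].
Qed.

Lemma smooth_tensor (a b : R -> R) : smooth_on setT a -> smooth_on setT b ->
  smooth_on setT (tensor a b).
Proof.
move=> Ca Cb m; apply: Ck_onM; first exact: openT.
  exact: smooth_comp_fst.
exact: smooth_comp_snd.
Qed.

Lemma derive_comp_fst (a : R -> R) v :
  'D_v (fun x : plane => a x.1) = fun x : plane => 'D_(v.1) a x.1.
Proof.
have := derive_comp_affine (@fst R R : {linear plane -> R}) 0 a v.
rewrite (_ : (fun x : plane => a (_ + 0)) = fun x : plane => a x.1); last first.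
  by apply/funext => x; rewrite addr0.
by move=> ->; apply/funext => x /=; rewrite addr0.
Qed.

Lemma derive_comp_snd (a : R -> R) v :
  'D_v (fun x : plane => a x.2) = fun x : plane => 'D_(v.2) a x.2.
Proof.
have := derive_comp_affine (@snd R R : {linear plane -> R}) 0 a v.
rewrite (_ : (fun x : plane => a (_ + 0)) = fun x : plane => a x.2); last first.
  by apply/funext => x; rewrite addr0.
by move=> ->; apply/funext => x /=; rewrite addr0.
Qed.

Lemma derive_tensor (a b : R -> R) (v : plane) :
  smooth_on setT a -> smooth_on setT b ->
  'D_v (tensor a b) = fun x => tensor a ('D_(v.2) b) x + tensor ('D_(v.1) a) b x.
Proof.
move=> Ca Cb; apply/funext => x.
have da : derivable (fun x : plane => a x.1) x v.
  by apply: diff_derivable; have [+ _] := smooth_comp_fst Ca 1; exact.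
have db : derivable (fun x : plane => b x.2) x v.
  by apply: diff_derivable; have [+ _] := smooth_comp_snd Cb 1; exact.
rewrite [LHS](deriveM da db).
rewrite (congr1 (@^~ x) (derive_comp_fst a v)).
rewrite (congr1 (@^~ x) (derive_comp_snd b v)).
by rewrite /tensor /GRing.scale /= [_ * b _]mulrC.
Qed.

Lemma pderiv10_tensor (a b : R -> R) : smooth_on setT a -> smooth_on setT b ->
  'D_((1, 0) : plane) (tensor a b) = tensor ('D_1 a) b.
Proof.
move=> Ca Cb; rewrite derive_tensor //=; apply/funext => x.
by rewrite {1}/tensor derive0 mulr0 add0r.
Qed.

Lemma pderiv01_tensor (a b : R -> R) : smooth_on setT a -> smooth_on setT b ->
  'D_((0, 1) : plane) (tensor a b) = tensor a ('D_1 b).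
Proof.
move=> Ca Cb; rewrite derive_tensor //=; apply/funext => x.
by rewrite {2}/tensor derive0 mul0r addr0.
Qed.

Lemma smooth_derive (a : R -> R) : smooth_on setT a -> smooth_on setT ('D_1 a).
Proof. by move=> Ca m; have [_ +] := Ca m.+1; exact. Qed.

End Tensor.

(** * Measurability of open sets of the plane *)

Section PlaneMeasure.
Context {R : realType}.
Local Notation plane := (R * R)%type.

(** The plane carries the product sigma-algebra, so an open set is reached as a countable union of
    rational boxes. Boxes not contained in [U] are replaced by the empty set, so that the union runs
    over all rational quadruples. *)
Lemma open_measurable_plane (U : set plane) : open U -> measurable U.
Proof.
move=> oU; pose box (q : (rat * rat) * (rat * rat)) : set plane :=
  `]ratr q.1.1, ratr q.1.2[ `*` `]ratr q.2.1, ratr q.2.2[.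
have -> : U = \bigcup_q (if asbool (box q `<=` U) then box q else set0).
  apply/seteqP; split=> [x Ux|x [q _]]; last by case: asboolP => // qU /qU.
  have [[A B] [/= Ax Bx] ABU] : nbhs x U by exact: open_nbhs_nbhs.
  have rat_nbhs (y : R) (D : set R) : nbhs y D -> exists q : rat * rat,
      ratr q.1 < y < ratr q.2 /\ [set z | ratr q.1 < z < ratr q.2] `<=` D.
    move=> /nbhs_ballP[e /= e0 eD].
    have [q1 q1I] := @rat_in_itvoo R (y - e) y ltac:(by rewrite ltrBlDr ltrDl).
    have [q2 q2I] := @rat_in_itvoo R y (y + e) ltac:(by rewrite ltrDl).
    move: q1I q2I; rewrite !in_itv /= => /andP[h1 h2] /andP[h3 h4].
    exists (q1, q2); split; first by rewrite h2 h3.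
    move=> z /= /andP[z1 z2]; apply: eD => /=.
    by rewrite /ball /= ltr_distlC (lt_trans h1 z1) (lt_trans z2 h4).
  have [q [xq qA]] := rat_nbhs _ _ Ax; have [q' [xq' qB]] := rat_nbhs _ _ Bx.
  exists (q, q') => //; case: asboolP => [_|[]]; first by split; rewrite /= in_itv.
  move=> [y z] [/=]; rewrite !in_itv /= => yq zq.
  by apply: ABU; split; [exact: qA|exact: qB].
apply: countable_bigcupT_measurable => // q; case: asboolP => // _.
by apply: measurableX; exact: measurable_itv.
Qed.

End PlaneMeasure.

(** * Integration on the plane *)

Section IntegralLemmas.
Context d (T : measurableType d) (R : realType).
Variable mu : {measure set T -> \bar R}.

Lemma Rintegral_support (D D' : set T) (f : T -> R) : D' `<=` D ->
  (forall x, ~ D' x -> f x = 0) ->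
  \int[mu]_(x in D) f x = \int[mu]_(x in D') f x.
Proof.
move=> D'D f0; rewrite Rintegral_mkcond [RHS]Rintegral_mkcond.
congr (Rintegral mu setT _); apply/funext => x; rewrite !patchE.
have [xD'|xD'] := boolP (x \in D').
  by rewrite (mem_set (D'D x (set_mem xD'))).
by rewrite f0 ?if_same // => /mem_set; apply/negP.
Qed.

(** If x > t, then x = t^(1-p) x^p (t/x)^(p-1) with last factor at most 1. Integrated over a set of
    finite measure, this replaces Hoelder's inequality: the parameter [t] balances the measure of
    the set against the L^p integral. *)
Lemma le_powR_split (p t x : R) : 1 <= p -> 0 < t -> 0 <= x ->
  x <= t + t `^ (1 - p) * x `^ p.
Proof.
move=> p1 t0 x0; have [xt|tx] := leP x t.
  by rewrite ler_wpDr // mulr_ge0 ?powR_ge0.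
have x0' : 0 < x := lt_trans t0 tx.
rewrite ler_wpDl ?(ltW t0) //.
have -> : t `^ (1 - p) * x `^ p = (x / t) `^ (p - 1) * x.
  rewrite powRM ?invr_ge0 ?(ltW t0) //.
  rewrite -powR_inv1 ?(ltW t0) // -powRrM mulN1r opprB.
  rewrite [RHS]mulrAC mulrC; congr (_ * _).
  by rewrite -[X in _ * X]powRr1 // -powRD ?subrK // lt0r_neq0 ?implybT.
rewrite ler_peMl // -[leLHS](powRr0 (x / t)) ler_powR ?subr_ge0 //.
by rewrite ler_pdivlMr // mul1r ltW.
Qed.

Lemma integral_abs_le_powR (p t : R) (D : set T) (f : T -> R) :
  1 <= p -> 0 < t -> measurable D -> measurable_fun D f ->
  (\int[mu]_(x in D) `|f x|%:E <=
   t%:E * mu D + (t `^ (1 - p))%:E * \int[mu]_(x in D) (`|f x| `^ p)%:E)%E.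
Proof.
move=> p1 t0 mD mf.
have mfa : measurable_fun D (fun x => `|f x|) by exact: measurableT_comp.
have mfp : measurable_fun D (fun x => `|f x| `^ p).
  exact: (@measurableT_comp _ _ _ _ _ _ (@powR R ^~ p)).
have mfpM : measurable_fun D
    (EFin \o (fun x => t `^ (1 - p) * `|f x| `^ p)).
  by apply/measurable_EFinP; exact: measurable_funM.
rewrite -integral_cst // -ge0_integralZl_EFin ?powR_ge0 //; last first.
  exact/measurable_EFinP.
rewrite -ge0_integralD //; last 2 first.
- by move=> x _; rewrite lee_fin ltW.
- by move=> x _; rewrite -EFinM lee_fin mulr_ge0 ?powR_ge0.
apply: ge0_le_integral => //.
- exact/measurable_EFinP.
- exact: emeasurable_funD.
- by move=> x _; rewrite /cst -EFinM -EFinD lee_fin le_powR_split.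
Qed.

Lemma powR_integrable (p : R) (D : set T) (f : T -> R) :
  1 <= p -> measurable D -> (mu D < +oo)%E -> measurable_fun D f ->
  (\int[mu]_(x in D) (`|f x| `^ p)%:E < +oo)%E ->
  mu.-integrable D (EFin \o f).
Proof.
move=> p1 mD muD mf fp; apply/integrableP; split; first exact/measurable_EFinP.
apply: le_lt_trans (integral_abs_le_powR p1 ltr01 mD mf) _.
rewrite mul1e powR1 mul1e lte_add_pinfty //.
Qed.

Lemma Rintegral_abs_le_powR (p t b : R) (D : set T) (f : T -> R) :
  1 <= p -> 0 < t -> measurable D -> (mu D < +oo)%E -> measurable_fun D f ->
  (\int[mu]_(x in D) (`|f x| `^ p)%:E <= b%:E)%E ->
  \int[mu]_(x in D) `|f x| <= t * fine (mu D) + t `^ (1 - p) * b.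
Proof.
move=> p1 t0 mD muD mf fp; rewrite -lee_fin /Rintegral fineK; last first.
  rewrite ge0_fin_numE; last by apply: integral_ge0 => x _; rewrite lee_fin.
  have := powR_integrable p1 mD muD mf (le_lt_trans fp (ltry _)).
  by move=> /integrableP[].
apply: le_trans (integral_abs_le_powR p1 t0 mD mf) _.
rewrite EFinD !EFinM fineK ?ge0_fin_numE //.
by rewrite leeD2l // lee_wpmul2l // lee_fin powR_ge0.
Qed.

Lemma integrable_mul_bounded (D : set T) (f h : T -> R) (M : R) :
  measurable D -> mu.-integrable D (EFin \o f) -> measurable_fun D h ->
  (forall x, D x -> `|h x| <= M) ->
  mu.-integrable D (EFin \o (fun x => f x * h x)).
Proof.
move=> mD fi mh hM; apply: (integrableMl mD fi mh).
exists M; split; first exact: num_real.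
by move=> y My x Dx; apply: le_trans (hM x Dx) (ltW My).
Qed.

Lemma Rintegral_mul_bounded (D : set T) (f h : T -> R) (M : R) :
  measurable D -> mu.-integrable D (EFin \o f) -> measurable_fun D h ->
  (forall x, D x -> `|h x| <= M) ->
  `|\int[mu]_(x in D) (f x * h x)| <= M * \int[mu]_(x in D) `|f x|.
Proof.
move=> mD fi mh hM.
have fhi := integrable_mul_bounded mD fi mh hM.
have fai : mu.-integrable D (EFin \o (fun x => `|f x|)) := integrable_norm fi.
apply: le_trans (le_normr_Rintegral mD fhi) _.
rewrite -RintegralZl //; apply: le_Rintegral => //.
- exact: (integrable_norm fhi).
- exact: (integrableZl mD M fai).
- by move=> x Dx; rewrite normrM mulrC ler_wpM2r // hM.
Qed.

End IntegralLemmas.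

Section PlaneIntegral.
Context {R : realType}.
Local Notation plane := (R * R)%type.
Local Notation mu := (@lebesgue_measure R).
Local Notation lebesgue2 := (@lebesgue_measure R \x @lebesgue_measure R)%E.

Lemma smooth_measurable (a : R -> R) (D : set R) :
  smooth_on setT a -> measurable D -> measurable_fun D a.
Proof.
move=> Ca mD; apply: measurable_funTS; apply: continuous_measurable_fun => x.
by apply: (Ca 0%N); rewrite inE.
Qed.

Lemma measurable_tensor (a b : R -> R) (D : set plane) : measurable D ->
  measurable_fun setT a -> measurable_fun setT b ->
  measurable_fun D (tensor a b).
Proof.
move=> mD ma mb; apply: measurable_funTS; apply: measurable_funM.
  by apply: measurableT_comp => //; exact: measurable_fst.
by apply: measurableT_comp => //; exact: measurable_snd.
Qed.

Lemma integral_tensor (a b : R -> R) (A B : set R) :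
  measurable A -> measurable B ->
  measurable_fun setT a -> measurable_fun setT b ->
  (forall x, 0 <= a x) -> (forall x, 0 <= b x) ->
  (\int[lebesgue2]_(x in A `*` B) (tensor a b x)%:E =
   \int[mu]_(x in A) (a x)%:E * \int[mu]_(y in B) (b y)%:E)%E.
Proof.
move=> mA mB ma mb a0 b0; rewrite integral_mkcond fubini_tonelli1 //=; last 2 first.
- apply/(measurable_restrictT _ (measurableX mA mB)).
  by apply/measurable_EFinP; apply: measurable_tensor => //; exact: measurableX.
- by move=> x; apply: erestrict_ge0 => y _; rewrite lee_fin mulr_ge0.
have aE x : (((fun x => (a x)%:E) \_ A) x = ((a \_ A) x)%:E)%E.
  by rewrite !patchE; case: ifP.
have FE x : fubini_F mu ((fun x => (tensor a b x)%:E) \_ (A `*` B)) x =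
    (((a \_ A) x)%:E * \int[mu]_(y in B) (b y)%:E)%E.
  rewrite /fubini_F -ge0_integralZl_EFin //; last 3 first.
  - by move=> y _; rewrite lee_fin.
  - by apply/measurable_EFinP; exact: measurable_funTS.
  - by rewrite patchE; case: ifP.
  rewrite [RHS]integral_mkcond; apply: eq_integral => y _.
  rewrite !patchE in_setX /=.
  by case: (x \in A); case: (y \in B); rewrite ?mul0e ?mule0.
transitivity (\int[mu]_x (((a \_ A) x)%:E *
    \int[mu]_(y in B) (b y)%:E))%E; first by apply: eq_integral => x _; exact: FE.
rewrite ge0_integralZr //; last 3 first.
- by apply/measurable_EFinP; apply/(measurable_restrictT _ mA);
    exact: measurable_funTS.
- by move=> x _; rewrite lee_fin patchE; case: ifP.
- by apply: integral_ge0 => x _; rewrite lee_fin.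
by rewrite [in RHS]integral_mkcond; congr (_ * _)%E; apply: eq_integral => x _.
Qed.

End PlaneIntegral.

(** * Derivatives of smooth steps as probability densities *)

Section Steps.
Context {R : realType}.
Local Notation mu := (@lebesgue_measure R).

Definition is_step (c e : R) (s : R -> R) : Prop :=
  [/\ smooth_on setT s, forall x, 0 <= s x <= 1, forall x, x <= c -> s x = 0,
      forall x, c + e <= x -> s x = 1 & forall x, 0 <= 'D_1 s x].

Context (c e : R) (s : R -> R) (e0 : 0 < e) (ss : is_step c e s).

Lemma step_derive_out x : (x < c) || (c + e < x) -> 'D_1 s x = 0.
Proof.
have [_ _ s0 s1 _] := ss; move=> /orP[xc|xc].
- rewrite (@near_eq_derive _ _ _ s (cst 0)) ?derive_cst //.
  by near=> y; rewrite s0 //; apply: ltW; near: y; exact: lt_nbhsl.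
- rewrite (@near_eq_derive _ _ _ s (cst 1)) ?derive_cst //.
  by near=> y; rewrite s1 //; apply: ltW; near: y; exact: lt_nbhsr.
Unshelve. all: by end_near. Qed.

Lemma step_derive_bounded : exists2 S, 0 <= S & forall x, `|'D_1 s x| <= S.
Proof.
have [Cs _ _ _ s'0] := ss.
have ce : c <= c + e by rewrite lerDl ltW.
have cs' : {within `[c, c + e], continuous 'D_1 s}.
  apply: continuous_subspaceT => x.
  by apply: (smooth_derive Cs 0%N); rewrite inE.
have [m _ mM] := EVT_max ce cs'.
exists ('D_1 s m) => // x; rewrite ger0_norm //.
have [/andP[cx xc]|] := boolP ((c <= x) && (x <= c + e)).
  by apply: mM; rewrite in_itv /= cx.
by rewrite negb_and -!ltNge => /step_derive_out ->.
Qed.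

(** The fundamental theorem of calculus gives [s b - s a], that is, 1 - 0. *)
Lemma integral_step_derive a b : a <= c -> c + e <= b ->
  (\int[mu]_(x in `[a, b]) ('D_1 s x)%:E = 1)%E.
Proof.
move=> ac cb; have [Cs _ s0 s1 s'0] := ss.
have ab : a < b by rewrite (le_lt_trans ac) // (lt_le_trans _ cb) // ltrDl.
have cs x : {for x, continuous s} by apply: (Cs 0%N); rewrite inE.
have cs' : continuous ('D_1 s).
  by move=> x; apply: (smooth_derive Cs 0%N); rewrite inE.
rewrite (@continuous_FTC2 _ _ s _ _ ab).
- by rewrite s1 // s0 // sube0.
- exact: continuous_subspaceT.
- split.
  + move=> x _; apply: diff_derivable.
    by have [+ _] := Cs 1%N; exact.
  + by apply: cvg_at_right_filter; exact: cs.
  + by apply: cvg_at_left_filter; exact: cs.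
- by move=> x _; rewrite derive1E.
Qed.

End Steps.

(** * Testing weak derivatives against tensor products *)

Section SobolevPointwise.
Context {R : realType}.
Local Notation plane := (R * R)%type.
Local Notation mu := (@lebesgue_measure R).
Local Notation lebesgue2 := (@lebesgue_measure R \x @lebesgue_measure R)%E.

Definition square (c : plane) (r : R) : set plane :=
  `[c.1 - r, c.1 + r] `*` `[c.2 - r, c.2 + r].

Lemma squareP c r (x : plane) :
  square c r x <-> `|x.1 - c.1| <= r /\ `|x.2 - c.2| <= r.
Proof.
by rewrite /square /= !in_itv /= !ler_distl.
Qed.

Lemma measurable_square c r : measurable (square c r).
Proof. by apply: measurableX; exact: measurable_itv. Qed.

Lemma compact_square c r : compact (square c r).
Proof. by apply: compact_setX; exact: segment_compact. Qed.

Lemma square_measure_fin c r : (lebesgue2 (square c r) < +oo)%E.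
Proof.
have itv_fin a b : (mu `[a, b] < +oo)%E.
  by rewrite lebesgue_measure_itv; case: ifP => _; rewrite ltry.
rewrite product_measure1E; [|exact: measurable_itv..].
apply: lte_mul_pinfty; rewrite ?ge0_fin_numE //; exact: itv_fin.
Qed.

Lemma smooth_derive_iter i (a : R -> R) :
  smooth_on setT a -> smooth_on setT (iter i (fun f : R -> R => 'D_(1 : R) f) a).
Proof. by move=> Ca; elim: i => [//|i IH]; exact: smooth_derive. Qed.

Lemma pderiv_tensor i j (a b : R -> R) :
  smooth_on setT a -> smooth_on setT b ->
  pderiv i j (tensor a b) =
  tensor (iter i (fun f : R -> R => 'D_(1 : R) f) a) (iter j (fun f : R -> R => 'D_(1 : R) f) b).
Proof.
move=> Ca Cb; rewrite /pderiv.
have -> : iter j (fun u => 'D_((0, 1) : plane) u) (tensor a b) =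
    tensor a (iter j (fun f : R -> R => 'D_(1 : R) f) b).
  elim: j => [//|j IH]; rewrite [LHS]iterS IH pderiv01_tensor //.
  exact: smooth_derive_iter.
elim: i => [//|i IH]; rewrite [LHS]iterS IH pderiv10_tensor //;
  exact: smooth_derive_iter.
Qed.

(** The strict inequality defines an open set, so vanishing on it is local and is inherited by every
    derivative. *)
Lemma derive_iter_support i (a : R -> R) (c r : R) :
  (forall x, r < `|x - c| -> a x = 0) ->
  forall x, r < `|x - c| -> iter i (fun f : R -> R => 'D_(1 : R) f) a x = 0.
Proof.
move=> a0; elim: i => [//|i IH] x xr.
rewrite [LHS](@near_eq_derive _ _ _ _ (cst 0)) ?derive_cst //.
have oS : open [set y : R | r < `|y - c|].
  apply: (@open_comp R R (fun y => `|y - c|) [set z | r < z]); last exact: open_gt.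
  by move=> y _; apply: cvg_norm; apply: cvgB; [exact: cvg_id|exact: cvg_cst].
by apply: filterS (open_nbhs_nbhs (conj oS xr)) => y; exact: IH.
Qed.

Lemma test_tensor (U : set plane) c r (a b : R -> R) :
  smooth_on setT a -> smooth_on setT b ->
  (forall x, r < `|x - c.1| -> a x = 0) ->
  (forall x, r < `|x - c.2| -> b x = 0) ->
  square c r `<=` U -> test_function U (tensor a b).
Proof.
move=> Ca Cb a0 b0 QU; split; first exact: smooth_tensor.
exists (square c r); split=> //; first exact: compact_square.
move=> x /squareP/not_andP[|] /negP; rewrite -ltNge => xr.
  by rewrite /tensor a0 // mul0r.
by rewrite /tensor b0 // mulr0.
Qed.

Lemma tensor_support c r (a b : R -> R) :
  (forall x, r < `|x - c.1| -> a x = 0) ->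
  (forall x, r < `|x - c.2| -> b x = 0) ->
  forall x, ~ square c r x -> tensor a b x = 0.
Proof.
move=> a0 b0 x /squareP/not_andP[|] /negP; rewrite -ltNge => xr.
  by rewrite /tensor a0 // mul0r.
by rewrite /tensor b0 // mulr0.
Qed.

Lemma plane_integral_support (U Q : set plane) (f : plane -> R) :
  Q `<=` U -> (forall x, ~ Q x -> f x = 0) ->
  \int[lebesgue2]_(x in U) f x = \int[lebesgue2]_(x in Q) f x.
Proof. exact: (@Rintegral_support _ _ R lebesgue2). Qed.

(** Weak differentiation moves all derivatives from the test function to [v], so the bound involves
    the suprema of [a] and [b] but not those of their derivatives. *)
Lemma weak_pderiv_tensor_bound (U : set plane) (u v : plane -> R) i j c r
    (a b : R -> R) (A B : R) :
  square c r `<=` U -> weak_pderiv U i j u v ->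
  lebesgue2.-integrable (square c r) (EFin \o v) ->
  smooth_on setT a -> smooth_on setT b ->
  (forall x, r < `|x - c.1| -> a x = 0) ->
  (forall x, r < `|x - c.2| -> b x = 0) ->
  (forall x, `|a x| <= A) -> (forall x, `|b x| <= B) ->
  `|\int[lebesgue2]_(x in square c r) (u x *
     tensor (iter i (fun f : R -> R => 'D_(1 : R) f) a) (iter j (fun f : R -> R => 'D_(1 : R) f) b) x)| <=
  A * B * \int[lebesgue2]_(x in square c r) `|v x|.
Proof.
move=> QU wv vi Ca Cb a0 b0 aA bB.
have := wv _ (test_tensor Ca Cb a0 b0 QU); rewrite pderiv_tensor //.
rewrite (plane_integral_support QU) => [->|x Qx]; last first.
  rewrite (tensor_support _ _ Qx) ?mulr0 //; exact: derive_iter_support.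
rewrite normrM normrX normrN1 expr1n mul1r.
rewrite (plane_integral_support QU) => [|x Qx]; last first.
  by rewrite (tensor_support _ _ Qx) ?mulr0.
apply: Rintegral_mul_bounded => //; first exact: measurable_square.
  by apply: measurable_tensor; [exact: measurable_square|exact: smooth_measurable..].
by move=> x _; rewrite normrM ler_pM.
Qed.

(** The product of the two step derivatives is a probability density carried by the square with
    corners [x] and [x + (e, e)], which lies inside [square c r]. The integral is therefore an
    average of values of [u] within [d] of [u x]. *)
Lemma integral_mul_tensor_steps (u : plane -> R) (c : plane) (r e d : R)
    (x : plane) (t1 t2 : R -> R) :
  0 < e -> `|x.1 - c.1| + e <= r -> `|x.2 - c.2| + e <= r ->
  is_step x.1 e t1 -> is_step x.2 e t2 ->
  lebesgue2.-integrable (square c r) (EFin \o u) ->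
  (forall y, `|y.1 - x.1| <= e -> `|y.2 - x.2| <= e -> `|u y - u x| <= d) ->
  `|u x| <= `|\int[lebesgue2]_(y in square c r)
               (u y * tensor ('D_1 t1) ('D_1 t2) y)| + d.
Proof.
move=> e0 x1r x2r st1 st2 ui ux; pose T := tensor ('D_1 t1) ('D_1 t2).
have [Ct1 _ _ _ t1'0] := st1; have [Ct2 _ _ _ t2'0] := st2.
have [S1 S10 t1S] := step_derive_bounded e0 st1.
have [S2 S20 t2S] := step_derive_bounded e0 st2.
have mQ := measurable_square c r.
have mT D : measurable D -> measurable_fun D T.
  by move=> mD; apply: measurable_tensor => //;
    apply: smooth_measurable => //; exact: smooth_derive.
have T0 y : 0 <= T y by rewrite mulr_ge0.
have TS y : `|T y| <= S1 * S2 by rewrite normrM ler_pM.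
have Ti : lebesgue2.-integrable (square c r) (EFin \o T).
  apply: measurable_bounded_integrable => //; [exact: square_measure_fin|exact: mT|].
  exists (S1 * S2); split; first exact: num_real.
  by move=> y My z _; exact: le_trans (TS z) (ltW My).
have uTi := @integrable_mul_bounded _ _ R lebesgue2 _ _ _ _ mQ ui (mT _ mQ) (fun y _ => TS y).
have T1 : \int[lebesgue2]_(y in square c r) T y = 1.
  rewrite /Rintegral integral_tensor //.
  - rewrite (integral_step_derive e0 st1) ?(integral_step_derive e0 st2) ?mule1 //.
    + by move: x2r (ler_norm (x.2 - c.2)) (ler_norm (c.2 - x.2));
        rewrite [`|c.2 - _|]distrC; lra.
    + by move: x2r (ler_norm (x.2 - c.2)); lra.
    + by move: x1r (ler_norm (x.1 - c.1)) (ler_norm (c.1 - x.1));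
        rewrite [`|c.1 - _|]distrC; lra.
    + by move: x1r (ler_norm (x.1 - c.1)); lra.
  - exact: smooth_measurable (smooth_derive Ct1) measurableT.
  - exact: smooth_measurable (smooth_derive Ct2) measurableT.
have uxTi : lebesgue2.-integrable (square c r) (EFin \o (fun y => u x * T y)).
  exact: (@integrableZl _ _ R lebesgue2 _ mQ (u x) _ Ti).
have dTi : lebesgue2.-integrable (square c r) (EFin \o (fun y => d * T y)).
  exact: (@integrableZl _ _ R lebesgue2 _ mQ d _ Ti).
have sub : `|u x - \int[lebesgue2]_(y in square c r) (u y * T y)| <= d.
  rewrite -[X in `|X - _|]mulr1 -T1 -(@RintegralZl _ _ R lebesgue2) // -(@RintegralB _ _ R lebesgue2) //.
  have di := @integrableB _ _ R lebesgue2 _ mQ _ _ uxTi uTi.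
  apply: le_trans (@le_normr_Rintegral _ _ R lebesgue2 _ _ mQ di) _.
  rewrite -[leRHS]mulr1 -T1 -(@RintegralZl _ _ R lebesgue2) //.
  apply: (@le_Rintegral _ _ R lebesgue2) => //.
    exact: (@integrable_norm _ _ R lebesgue2 _ _ di).
  move=> y _; rewrite -mulrBl normrM (ger0_norm (T0 y)).
  have [/andP[y1 y2]|] := boolP ((`|y.1 - x.1| <= e) && (`|y.2 - x.2| <= e)).
    by rewrite ler_wpM2r // distrC ux.
  rewrite negb_and -!ltNge => yx; suff -> : T y = 0 by rewrite !mulr0.
  have out t (z w : R) : is_step z e t -> e < `|w - z| -> 'D_1 t w = 0.
    move=> st wz; apply: (step_derive_out st).
    by move: wz; rewrite ltr_normr => /orP[wz|wz]; apply/orP; [right|left]; lra.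
  by case/orP: yx => yx; rewrite /T /tensor;
    [rewrite (out _ _ _ st1) // mul0r|rewrite (out _ _ _ st2) // mulr0].
rewrite -lerBlDl; apply: le_trans sub.
exact: lerB_dist.
Qed.

End SobolevPointwise.

(** * The Sobolev embedding *)

Section SobolevEmbedding.
Context {R : realType}.
Local Notation plane := (R * R)%type.
Local Notation lebesgue2 := (@lebesgue_measure R \x @lebesgue_measure R)%E.

Lemma smooth_sub (a b : R -> R) : smooth_on setT a -> smooth_on setT b ->
  smooth_on setT (fun x => a x - b x : R).
Proof.
move=> Ca Cb m; apply: Ck_onD => //; first exact: openT.
by apply: Ck_onN => //; exact: openT.
Qed.

Lemma derive_sub_smooth (a b : R -> R) x :
  smooth_on setT a -> smooth_on setT b ->
  'D_1 (fun x => a x - b x : R) x = 'D_1 a x - 'D_1 b x.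
Proof.
move=> Ca Cb; rewrite deriveB //; apply: diff_derivable.
  by have [+ _] := Ca 1%N; exact.
by have [+ _] := Cb 1%N; exact.
Qed.

(** Both steps are 0 left of [c - r] and 1 right of [c + 2 * r]. The doubled radius in the estimates
    below comes from here. *)
Lemma step_sub_support (z x c r e : R) (t s : R -> R) : 0 < e <= r ->
  `|x - c| <= r -> is_step x e t -> is_step (c + r) r s ->
  2 * r < `|z - c| -> t z - s z = 0.
Proof.
move=> /andP[e0 er]; rewrite ler_distl => /andP[x1 x2] [_ _ t0 t1 _] [_ _ s0 s1 _].
rewrite ltr_normr => /orP[zr|zr].
  by rewrite t1 ?s1 ?subrr //; lra.
by rewrite t0 ?s0 ?subrr //; lra.
Qed.

Lemma step_sub_bound (x e c e' z : R) (t s : R -> R) :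
  is_step x e t -> is_step c e' s -> `|t z - s z| <= 1.
Proof.
move=> [_ /(_ z)/andP[t0 t1] _ _ _] [_ /(_ z)/andP[s0 s1] _ _ _].
by rewrite ler_norml; apply/andP; split; lra.
Qed.

Lemma continuous_at_square (u : plane -> R) (x : plane) (r d : R) :
  {for x, continuous u} -> 0 < r -> 0 < d -> exists2 e, 0 < e <= r &
    forall y : plane, `|y.1 - x.1| <= e -> `|y.2 - x.2| <= e -> `|u y - u x| <= d.
Proof.
move=> cu r0 d0.
have /nbhs_ballP[e /= e0 eu] : \forall y \near x, `|u x - u y| <= d.
  by apply: (@cvgr_dist_le _ _ _ _ _ _ _ cu).
exists (Num.min r (e / 2)); first by rewrite lt_min r0 divr_gt0 //= ge_min lexx.
move=> y; rewrite !le_min => /andP[_ y1] /andP[_ y2]; rewrite distrC; apply: eu.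
by split; rewrite /ball /= distrC; [apply: le_lt_trans y1 _|apply: le_lt_trans y2 _];
  rewrite ltr_pdivrMr // ltr_pMr // ltr1n.
Qed.

(* With [rho] and [sigma] the derivatives of steps near [x] and away from [x],
   and [alpha] the difference of the two steps,
   [rho1 rho2 = (alpha1' + sigma1) (alpha2' + sigma2)]; each of the four terms is
   a derivative of order at most [(1, 1)] of a test function bounded
   independently of [rho], and [rho1 rho2] approximates the Dirac mass at [x]. *)
Lemma sobolev_pointwise (c : plane) (r : R) : 0 < r ->
  exists2 M, 0 <= M & forall (U : set plane) (u : plane -> R)
      (v : nat -> nat -> plane -> R),
    square c (2 * r) `<=` U -> {in U, continuous u} ->
    lebesgue2.-integrable (square c (2 * r)) (EFin \o u) ->
    (forall i j, (i <= 1)%N -> (j <= 1)%N ->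
      lebesgue2.-integrable (square c (2 * r)) (EFin \o v i j) /\
      weak_pderiv U i j u (v i j)) ->
    forall x, square c r x -> `|u x| <= M *
      (\int[lebesgue2]_(y in square c (2 * r)) `|v 1%N 1%N y| +
       \int[lebesgue2]_(y in square c (2 * r)) `|v 0%N 1%N y| +
       (\int[lebesgue2]_(y in square c (2 * r)) `|v 1%N 0%N y| +
       \int[lebesgue2]_(y in square c (2 * r)) `|v 0%N 0%N y|)).
Proof.
move=> r0.
have [s1 st1] := @smooth_step R (c.1 + r) r r0.
have [s2 st2] := @smooth_step R (c.2 + r) r r0.
have [S1 S10 s1S] := step_derive_bounded r0 st1.
have [S2 S20 s2S] := step_derive_bounded r0 st2.
(* [1 + S1] dominates both possible first factors: the difference of steps, at most 1, and the
   derivative of the fixed step, at most [S1]; likewise [1 + S2]. The derivatives of the narrow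
   steps must stay out of this constant, since no bound on them is uniform in [e]. *)
exists ((1 + S1) * (1 + S2)); first by rewrite mulr_ge0 // addr_ge0.
move=> U u v QU cu ui vi x /squareP[x1 x2]; apply/ler_addgt0Pr => d d0.
have xU : U x.
  by apply: QU; apply/squareP; split; [apply: le_trans x1 _|apply: le_trans x2 _];
    rewrite ler_pMl // ler1n.
have [e er eu] := continuous_at_square (cu x (mem_set xU)) r0 d0.
have /andP[e0 er'] := er.
have [t1 tt1] := @smooth_step R x.1 e e0.
have [t2 tt2] := @smooth_step R x.2 e e0.
have := @integral_mul_tensor_steps R u c (2 * r) e d x t1 t2 e0 _ _ tt1 tt2 ui eu.
have dbl z : z <= r -> z + e <= 2 * r by lra.
move=> /(_ (dbl _ x1) (dbl _ x2)) /le_trans; apply; rewrite lerD2r.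
have [Ct1 _ _ _ _] := tt1; have [Ct2 _ _ _ _] := tt2.
have [Cs1 _ _ _ _] := st1; have [Cs2 _ _ _ _] := st2.
pose a1 z := t1 z - s1 z; pose a2 z := t2 z - s2 z.
have Ca1 : smooth_on setT a1 by exact: smooth_sub.
have Ca2 : smooth_on setT a2 by exact: smooth_sub.
have a1E z : 'D_1 a1 z = 'D_1 t1 z - 'D_1 s1 z by exact: derive_sub_smooth.
have a2E z : 'D_1 a2 z = 'D_1 t2 z - 'D_1 s2 z by exact: derive_sub_smooth.
have Csig1 := smooth_derive Cs1; have Csig2 := smooth_derive Cs2.
have a1s z : 2 * r < `|z - c.1| -> a1 z = 0 := step_sub_support er x1 tt1 st1.
have a2s z : 2 * r < `|z - c.2| -> a2 z = 0 := step_sub_support er x2 tt2 st2.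
have out y s z : is_step (y + r) r s -> 2 * r < `|z - y| -> 'D_1 s z = 0.
  move=> st zy; apply: (step_derive_out st).
  by move: zy; rewrite ltr_normr => /orP[zy|zy]; apply/orP; [right|left]; lra.
have sig1s z : 2 * r < `|z - c.1| -> 'D_1 s1 z = 0 by exact: out.
have sig2s z : 2 * r < `|z - c.2| -> 'D_1 s2 z = 0 by exact: out.
have a1b z : `|a1 z| <= 1 + S1.
  by apply: le_trans (step_sub_bound z tt1 st1) _; rewrite lerDl.
have a2b z : `|a2 z| <= 1 + S2.
  by apply: le_trans (step_sub_bound z tt2 st2) _; rewrite lerDl.
have sig1b z : `|'D_1 s1 z| <= 1 + S1 by apply: le_trans (s1S z) _; rewrite lerDr.
have sig2b z : `|'D_1 s2 z| <= 1 + S2 by apply: le_trans (s2S z) _; rewrite lerDr.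
(* These bounds depend on [e]; they justify splitting the integral but do not enter the estimate. *)
have [T1 T10 t1T] := step_derive_bounded e0 tt1.
have [T2 T20 t2T] := step_derive_bounded e0 tt2.
have da1b z : `|'D_1 a1 z| <= T1 + S1.
  by rewrite a1E; apply: le_trans (ler_normB _ _) _; exact: lerD.
have da2b z : `|'D_1 a2 z| <= T2 + S2.
  by rewrite a2E; apply: le_trans (ler_normB _ _) _; exact: lerD.
pose Q := square c (2 * r).
have mQ : measurable Q := measurable_square c (2 * r).
have int (a b : R -> R) (A B : R) : smooth_on setT a -> smooth_on setT b ->
    (forall z, `|a z| <= A) -> (forall z, `|b z| <= B) ->
    lebesgue2.-integrable Q (EFin \o (fun y => u y * tensor a b y)).
  move=> Ca Cb aA bB.
  apply: (@integrable_mul_bounded _ _ R lebesgue2 _ _ _ (A * B) mQ ui).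
    by apply: measurable_tensor => //; exact: smooth_measurable.
  by move=> y _; rewrite normrM ler_pM.
have i11 := int _ _ _ _ (smooth_derive Ca1) (smooth_derive Ca2) da1b da2b.
have i01 := int _ _ _ _ Csig1 (smooth_derive Ca2) sig1b da2b.
have i10 := int _ _ _ _ (smooth_derive Ca1) Csig2 da1b sig2b.
have i00 := int _ _ _ _ Csig1 Csig2 sig1b sig2b.
have -> : \int[lebesgue2]_(y in Q) (u y * tensor ('D_1 t1) ('D_1 t2) y) =
    \int[lebesgue2]_(y in Q) (u y * tensor ('D_1 a1) ('D_1 a2) y) +
    \int[lebesgue2]_(y in Q) (u y * tensor ('D_1 s1) ('D_1 a2) y) +
    (\int[lebesgue2]_(y in Q) (u y * tensor ('D_1 a1) ('D_1 s2) y) +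
     \int[lebesgue2]_(y in Q) (u y * tensor ('D_1 s1) ('D_1 s2) y)).
  have j1 := @integrableD _ _ R lebesgue2 _ mQ _ _ i11 i01.
  have j2 := @integrableD _ _ R lebesgue2 _ mQ _ _ i10 i00.
  have e1 := @RintegralD _ _ R lebesgue2 _ _ _ mQ i11 i01.
  have e2 := @RintegralD _ _ R lebesgue2 _ _ _ mQ i10 i00.
  have e3 := @RintegralD _ _ R lebesgue2 _ _ _ mQ j1 j2.
  apply: etrans (etrans e3 (f_equal2 +%R e1 e2)).
  by apply: eq_Rintegral => y _; rewrite /= /tensor a1E a2E; ring.
have [i1 w1] := vi 1%N 1%N isT isT; have [i2 w2] := vi 0%N 1%N isT isT.
have [i3 w3] := vi 1%N 0%N isT isT; have [i4 w4] := vi 0%N 0%N isT isT.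
set M := (1 + S1) * _; rewrite !(mulrDr M); apply: le_trans (ler_normD _ _) _; apply: lerD;
  apply: le_trans (ler_normD _ _) _; apply: lerD.
- exact: weak_pderiv_tensor_bound QU w1 i1 Ca1 Ca2 a1s a2s a1b a2b.
- exact: weak_pderiv_tensor_bound QU w2 i2 Csig1 Ca2 sig1s a2s sig1b a2b.
- exact: weak_pderiv_tensor_bound QU w3 i3 Ca1 Csig2 a1s sig2s a1b sig2b.
- exact: weak_pderiv_tensor_bound QU w4 i4 Csig1 Csig2 sig1s sig2s sig1b sig2b.
Qed.

End SobolevEmbedding.

(** * From a small Sobolev norm to a small supremum *)

Section SobolevNorm.
Context {R : realType}.
Local Notation plane := (R * R)%type.
Local Notation lebesgue2 := (@lebesgue_measure R \x @lebesgue_measure R)%E.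

Lemma Lp_loc_integrable (p : R) (U Q : set plane) (v : plane -> R) :
  1 <= p -> open U -> measurable Q -> (lebesgue2 Q < +oo)%E -> compact Q ->
  Q `<=` U -> Lp_loc p U v ->
  measurable_fun Q v /\ lebesgue2.-integrable Q (EFin \o v).
Proof.
move=> p1 oU mQ Qfin cQ QU [mv vp].
have mvQ : measurable_fun Q v.
  exact: (measurable_funS (open_measurable_plane oU) QU mv).
split=> //.
exact: (@powR_integrable _ _ R lebesgue2 p Q v p1 mQ Qfin mvQ (vp Q cQ QU)).
Qed.

Lemma sobolev_order_ge2 (k : nat) (p : R) :
  1 <= p -> 1 < k%:R - 2 / p -> (2 <= k)%N.
Proof.
move=> p1 kp; rewrite -(ltr_nat R) (lt_trans kp) // ltrBlDr ltrDl.
by rewrite divr_gt0 // (lt_le_trans ltr01).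
Qed.

Lemma le_fin_sume (I : finType) (P : pred I) (F : I -> \bar R) (i : I) :
  P i -> (forall j, 0 <= F j)%E -> (F i <= \sum_(j | P j) F j)%E.
Proof. by move=> Pi F0; rewrite (bigD1 i) //= leeDl // sume_ge0. Qed.

(** It suffices to bring each of the four L^1 norms in [sobolev_pointwise] below some [B]. By
    [le_powR_split] each is at most t m + t^(1-p) E, where m is the area of the square and E bounds
    the L^p integral. *)
Lemma Lkp_norm_sup (n k : nat) (p : R) (c : plane) (r eta : R) :
  1 <= p -> 1 < k%:R - 2 / p -> 0 < r -> 0 < eta -> exists2 e, 0 < e &
  forall (U : set plane) (u : plane -> 'rV[R]_n), open U ->
    square c (2 * r) `<=` U ->
    (forall j, {in U, continuous (fun x => u x ord0 j : R)}) ->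
    Lkp_norm_lt k p U u (square c (2 * r)) e ->
    forall x, square c r x -> forall j, `|u x ord0 j| < eta.
Proof.
move=> p1 kp r0 eta0; have k2 := sobolev_order_ge2 p1 kp.
have [M M0 MP] := sobolev_pointwise c r0.
set Q := square c (2 * r) in MP *.
have mQ : measurable Q := measurable_square c (2 * r).
have Qfin : (lebesgue2 Q < +oo)%E := square_measure_fin c (2 * r).
pose m := fine (lebesgue2 Q).
have m0 : 0 <= m by rewrite fine_ge0.
(* Four norms below [B] give at most 4 M B = eta M / (2 (M + 1)), which is less than [eta], also for
   [M = 0]. *)
pose B := eta / (8 * (M + 1)).
have B0 : 0 < B by rewrite divr_gt0 // mulr_gt0 // ltr_wpDl.
(* This choice makes t m at most B / 2, and the next one makes t^(1-p) E equal to B / 2. *)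
pose t := B / (2 * (m + 1)).
have t0 : 0 < t by rewrite divr_gt0 // mulr_gt0 // ltr_wpDl.
pose E := t `^ (p - 1) * (B / 2).
have E0 : 0 < E by rewrite mulr_gt0 ?powR_gt0 // divr_gt0.
(* With e at most 1 and p at least 1, e^p is at most e, hence at most [E], without taking a p-th
   root. *)
pose e := Num.min 1 E.
have e0 : 0 < e by rewrite lt_min ltr01.
exists e => // U u oU QU cu [v jv vs] x xQ j.
have [uL vL] := jv j.
have bound a b : (a <= 1)%N -> (b <= 1)%N ->
    lebesgue2.-integrable Q (EFin \o v j a b) /\
    \int[lebesgue2]_(y in Q) `|v j a b y| <= B.
  move=> a1 b1; have abk : (a + b <= k)%N := leq_trans (leq_add a1 b1) k2.
  have [vab _] := vL a b abk.
  have [mv vi] := Lp_loc_integrable p1 oU mQ Qfin (compact_square (c := c) (r := 2 * r)) QU vab.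
  split=> //.
  have ep : (\int[lebesgue2]_(y in Q) (`|v j a b y| `^ p)%:E <= E%:E)%E.
    have ak : (a < k.+1)%N := leq_trans (leq_addr b a) abk.
    have bk : (b < k.+1)%N := leq_trans (leq_addl a b) abk.
    have int0 j' (a' b' : nat) :
        (0 <= \int[lebesgue2]_(y in Q) (`|v j' a' b' y| `^ p)%:E)%E.
      by apply: integral_ge0 => y _; rewrite lee_fin powR_ge0.
    apply: (@le_trans _ _ (e `^ p)%:E).
      apply: le_trans (ltW vs).
      apply: le_trans (le_fin_sume (i := j) _ _); last 2 first.
      - by [].
      - by move=> j'; do 2 (apply: sume_ge0 => ? _).
      apply: le_trans (le_fin_sume (i := Ordinal ak) _ _); last 2 first.
      - by [].
      - by move=> a'; apply: sume_ge0 => ? _.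
      exact: (@le_fin_sume _ (fun b' : 'I_k.+1 => (a + b' <= k)%N)
        (fun b' => \int[lebesgue2]_(y in Q) (`|v j a b' y| `^ p)%:E)%E
        (Ordinal bk)).
    rewrite lee_fin; apply: (@le_trans _ _ e); last by rewrite ge_min lexx orbT.
    rewrite -[leRHS]powRr1 ?(ltW e0) //; apply: ger_powR => //.
    by rewrite e0 ge_min lexx.
  apply: le_trans (@Rintegral_abs_le_powR _ _ R lebesgue2 p t E Q _ p1 t0 mQ Qfin mv ep) _.
  rewrite -/m /E mulrA -powRD; last by rewrite lt0r_neq0 ?implybT.
  rewrite (_ : 1 - p + (p - 1) = 0) ?powRr0 ?mul1r; last by ring.
  rewrite [leRHS]splitr lerD2r /t mulrAC ler_pdivrMr ?mulr_gt0 ?ltr_wpDl //.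
  rewrite (_ : B / 2 * (2 * (m + 1)) = B * (m + 1)); last by field.
  by rewrite ler_pM2l // lerDl.
have [_ ui] := Lp_loc_integrable p1 oU mQ Qfin (compact_square (c := c) (r := 2 * r)) QU uL.
have := MP U _ (v j) QU (cu j) ui _ x xQ => /(_ _)/le_lt_trans; apply.
  move=> a b a1 b1; split; first by have [] := bound a b a1 b1.
  by have [] := vL a b (leq_trans (leq_add a1 b1) k2).
have [_ b11] := bound 1%N 1%N isT isT; have [_ b01] := bound 0%N 1%N isT isT.
have [_ b10] := bound 1%N 0%N isT isT; have [_ b00] := bound 0%N 0%N isT isT.
apply: (@le_lt_trans _ _ (M * (B + B + (B + B)))).
  by rewrite ler_wpM2l // !lerD.
have -> : M * (B + B + (B + B)) = eta * (M / (2 * (M + 1))).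
  by rewrite /B; field; rewrite lt0r_neq0 // ltr_wpDl.
rewrite gtr_pMr // ltr_pdivrMr ?mulr_gt0 ?ltr_wpDl //.
by clear -M0; lra.
Qed.

End SobolevNorm.

(** * Evaluation and reparametrization are continuous *)

Section SobolevTopology.
Context (R : realType) (n : nat) (M : topologicalType).
Context (A : set (chart M 'rV[R]_n)) (k : nat) (p : R).
Local Notation plane := (R * R)%type.
Local Notation sphere := (sphere R).
Local Notation smap := (sobolev_map A k p).

Lemma sobolev_subbase_open (N : set smap) : sobolev_subbase N -> open N.
Proof.
move=> sN; exists [set N]; last by rewrite bigcup_set1.
by move=> _ ->; exact: (@finI_from1 _ _ (@sobolev_subbase R n M A k p) id).
Qed.

Lemma sobolev_continuous_subbase (T : smap -> smap) :
  (forall N, sobolev_subbase N -> open (T @^-1` N)) -> continuous T.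
Proof.
move=> Tsub; apply/continuousP => N [D' D'fin <-]; rewrite openE => f [N' D'N' N'f].
have [E Esub EN'] := D'fin _ D'N'.
suff : nbhs f (T @^-1` N') by apply: filterS => g N'g; exists N'.
rewrite -EN' preimage_bigcap; apply: filter_bigI => V EV.
apply: open_nbhs_nbhs; split; last by move: N'f; rewrite -EN'; apply.
by apply: Tsub; have := Esub V EV; rewrite inE.
Qed.

Lemma local_dom_precomp (f : sphere -> M) (psi : chart sphere plane)
    (phi : chart M 'rV[R]_n) (g : moebius R) :
  local_dom f (moebius_precomp psi (moebius_inv g)) phi =
  local_dom (f \o g) psi phi.
Proof.
apply/seteqP; split=> [_ [x [/= px fx] <-]|_ [x [/= px fx] <-]].
- by exists (moebius_inv g x) => //; split => //=; rewrite moebiusVK.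
- by exists (g x); [split; rewrite //= moebiusK|rewrite /= moebiusK].
Qed.

Lemma local_rep_precomp (f : sphere -> M) (psi : chart sphere plane)
    (phi : chart M 'rV[R]_n) (g : moebius R) :
  local_rep f (moebius_precomp psi (moebius_inv g)) phi =
  local_rep (f \o g) psi phi.
Proof.
apply/funext => x; rewrite /local_rep /=; congr (phi (f _)).
by rewrite -[LHS](moebiusVK g) (moebiusVK (moebius_inv g)).
Qed.

(** Moving [f], [psi] and [K] along [g] leaves local expressions unchanged, because the chart psi o
    g^-1 undoes the precomposition with [g]. Preimages of subbasic sets are thus subbasic, as the
    maximal atlas contains psi o g^-1. *)
Lemma reparam_preimage_nbhd (g : moebius R) (f : smap) psi phi K e :
  reparam g @^-1` sobolev_nbhd f psi phi K e =
  sobolev_nbhd (reparam (moebius_inv g) f)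
    (moebius_precomp psi (moebius_inv g)) phi (g @` K) e.
Proof.
have fE : reparam (moebius_inv g) f \o g = f :> (sphere -> M).
  by apply/funext => x; rewrite /= moebiusK.
have KE : moebius_precomp psi (moebius_inv g) @` (g @` K) = psi @` K.
  apply/seteqP; split=> [_ [_ [x Kx <-] <-]|_ [x Kx <-]].
    by exists x; rewrite //= moebiusK.
  by exists (g x); [exists x|rewrite /= moebiusK].
apply/seteqP; split=> h; rewrite /sobolev_nbhd /= => -[Kh hK]; split.
- by move=> _ [x Kx <-]; exact: Kh.
- by rewrite !local_dom_precomp !local_rep_precomp fE KE.
- by move=> x Kx; apply: Kh; exists x.
- by move: hK; rewrite !local_dom_precomp !local_rep_precomp fE KE.
Qed.

Lemma reparam_action_continuous (g : moebius R) :
  continuous (reparam g : smap -> smap).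
Proof.
apply: sobolev_continuous_subbase => N.
move=> [f [psi [phi [K [e [[mpsi mphi cK Kpsi Kf] [e0 ->]]]]]]]; rewrite reparam_preimage_nbhd.
apply: sobolev_subbase_open; exists (reparam (moebius_inv g) f).
exists (moebius_precomp psi (moebius_inv g)), phi, (g @` K), e; split=> //.
split=> //; first exact: max_atlas_precomp.
- by apply: continuous_compact => //; apply: continuous_subspaceT;
    exact: moebius_continuous.
- by move=> _ [x Kx <-] /=; rewrite moebiusK; exact: Kpsi.
- by move=> _ [x Kx <-] /=; rewrite moebiusK; exact: Kf.
Qed.

Lemma local_dom_open (f : sphere -> M) (psi : chart sphere plane)
    (phi : chart M 'rV[R]_n) : continuous f -> open (local_dom f psi phi).
Proof.
move=> cf; rewrite openE => _ [x [px fx] <-]; rewrite /interior.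
have inv_c := chart_inv_continuous (mem_set (imageP psi px)).
have near_im : \forall y \near psi x, (psi @` chart_dom psi) y.
  by apply: open_nbhs_nbhs; split; [exact: chart_im_open|exact: imageP].
have near_f : \forall y \near psi x, chart_dom phi (f (chart_inv psi y)).
  apply: (inv_c (f @^-1` chart_dom phi)).
  rewrite (chart_mapK (mem_set px)); apply: cf.
  by apply: open_nbhs_nbhs; split; first exact: chart_dom_open.
apply: filterS2 near_im near_f => _ [y py <-].
by rewrite (chart_mapK (mem_set py)) => fy; exists y.
Qed.

Lemma local_rep_continuous (f : sphere -> M) (psi : chart sphere plane)
    (phi : chart M 'rV[R]_n) : continuous f ->
  {in local_dom f psi phi, continuous (local_rep f psi phi)}.
Proof.
move=> cf _ /set_mem[x [px fx] <-].
apply: (@continuous_comp _ _ _ (chart_inv psi) (phi \o f)).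
  exact: chart_inv_continuous (mem_set (imageP psi px)).
rewrite (chart_mapK (mem_set px)).
apply: continuous_comp; first exact: cf.
exact: chart_map_continuous (mem_set fx).
Qed.

Lemma Lkp_norm_lt0 (U K : set plane) (e : R) : 1 <= p -> 0 < e ->
  Lkp_norm_lt k p U (fun=> 0 : 'rV[R]_n) K e.
Proof.
move=> p1 e0.
(* The power of 0 with exponent 0 is 1, so the vanishing of the integrand depends on this. *)
have p0 : p != 0 by rewrite gt_eqF // (lt_le_trans ltr01).
have int0 (D : set plane) :
    (\int[@lebesgue_measure R \x @lebesgue_measure R]_(x in D)
      (`|0 : R| `^ p)%:E = 0)%E.
  by rewrite normr0 powR0 //; exact: integral0.
have Lp0 : Lp_loc p U (fun=> 0 : R).
  by split=> [|D _ _]; [exact: measurable_cst|rewrite int0].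
exists (fun _ _ _ _ => 0).
  move=> j; have -> : (fun x : plane => (fun=> 0 : 'rV[R]_n) x ord0 j) = fun=> 0.
    by apply/funext => x; rewrite mxE.
  split=> // a b _; split=> // h _.
  have -> : (fun x => 0 * pderiv a b h x) = fun=> 0.
    by apply/funext => x; rewrite mul0r.
  have -> : (fun x => 0 * h x) = fun=> 0 by apply/funext => x; rewrite mul0r.
  by rewrite /Rintegral integral0 mulr0.
rewrite big1 => [|j _]; first by rewrite lte_fin powR_gt0.
by rewrite big1 // => a _; rewrite big1 // => b _; exact: int0.
Qed.

Lemma sobolev_nbhd_refl (f : smap) psi phi (K : set sphere) (e : R) :
  1 <= p -> 0 < e -> K `<=` f @^-1` chart_dom phi ->
  sobolev_nbhd f psi phi K e f.
Proof.
move=> p1 e0 Kf; split=> //.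
rewrite (_ : (fun x => _) = fun=> 0); first exact: Lkp_norm_lt0.
by apply/funext => x; rewrite subrr.
Qed.

Lemma moebius_to_finite (z : sphere) :
  exists g : moebius R, range Some (g z).
Proof.
case: z => [z|].
  have idP : exists a b c d : R[i], a * d - b * c != 0 /\
      moebius_fun 1 0 0 1 = moebius_fun a b c d.
    by exists 1, 0, 0, 1; rewrite !mulr1 mulr0 subr0 oner_neq0.
  exists (Moebius idP), z => //.
  exact: esym (moebius_fun_scalar (oner_neq0 _) (Some z)).
have invP : exists a b c d : R[i], a * d - b * c != 0 /\
    moebius_fun 0 1 1 0 = moebius_fun a b c d.
  by exists 0, 1, 1, 0; split=> //; exact: inversion_det.
by exists (Moebius invP); rewrite /= oner_eq0; eexists.
Qed.

Lemma nbhs_square (c : plane) (O : set plane) : nbhs c O ->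
  exists2 r : R, 0 < r & square c (2 * r) `<=` O.
Proof.
move=> /nbhs_ballP[e /= e0 eO]; exists (e / 4); first by rewrite divr_gt0.
move=> x /squareP[x1 x2]; apply: eO.
by split; rewrite /ball /= distrC; [apply: le_lt_trans x1 _|apply: le_lt_trans x2 _];
  lra.
Qed.

Lemma square_nbhs (c : plane) (r : R) : 0 < r -> nbhs c (square c r).
Proof.
move=> r0; apply/nbhs_ballP; exists r => // x [x1 x2]; apply/squareP.
by split; rewrite distrC ltW.
Qed.

(** This is joint continuity: one [N] serves all [w] near [z]. In a chart, phi (f w) is within eta /
    2 of phi (f z) by continuity of [f], and phi (g w) is within eta / 2 of phi (f w) by
    [Lkp_norm_sup], uniformly for psi w in a small square. *)
Lemma sobolev_eval_continuous (f : smap) (z : sphere) (V : set M) :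
  smooth_atlas A -> 1 <= p -> 1 < k%:R - 2 / p -> nbhs (f z) V ->
  exists2 N : set smap, open N /\ N f &
    \forall w \near z, forall g, N g -> V (g w).
Proof.
move=> [Acover Acompat] p1 kp fzV.
have cf := sobolev_continuous (s := f).
have [phi Aphi fz] := Acover (f z).
have mphi : max_atlas A phi by move=> chi; exact: Acompat.
have [h hz] := moebius_to_finite z.
pose psi := affine_chart h.
have mpsi : max_atlas (@sphere_atlas R) psi by exact: affine_chart_max.
have pz : chart_dom psi z by exact: hz.
have phi_inv : nbhs (phi (f z)) (chart_inv phi @^-1` V).
  apply: (chart_inv_continuous (mem_set (imageP phi fz))).
  by rewrite (chart_mapK (mem_set fz)).
have [eta /= eta0 etaV] := (nbhs_ballP _ _).1 phi_inv.
have eta20 : 0 < eta / 2 by rewrite divr_gt0.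
pose O := [set w | chart_dom phi (f w) /\
                   ball (phi (f z)) (eta / 2) (phi (f w))].
have near_phi : nbhs z O.
  apply: filterI.
    by apply: cf; apply: open_nbhs_nbhs; split; first exact: chart_dom_open.
  have := @continuous_comp _ _ _ f phi z (cf z) (chart_map_continuous (mem_set fz)).
  by apply; exact: nbhsx_ballx.
have near_c : nbhs (psi z) (psi @` chart_dom psi `&` chart_inv psi @^-1` O).
  apply: filterI.
    by apply: open_nbhs_nbhs; split; [exact: chart_im_open|exact: imageP].
  apply: (chart_inv_continuous (mem_set (imageP psi pz))).
  by rewrite (chart_mapK (mem_set pz)).
have [r r0 rQ] := nbhs_square near_c.
set c := psi z in near_c rQ.
(* The norm is measured over the double square, while the supremum is controlled only on the inner
   one; points [w] are later taken in the inner square. *)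
pose K := chart_inv psi @` square c (2 * r).
have pinvK x : square c (2 * r) x -> psi (chart_inv psi x) = x.
  by move=> /rQ[[w pw <-] _]; rewrite (chart_mapK (mem_set pw)).
have Kpsi : K `<=` chart_dom psi.
  by move=> _ [x /rQ[[w pw <-] _] <-]; rewrite (chart_mapK (mem_set pw)).
have psiK : psi @` K = square c (2 * r).
  apply/seteqP; split=> [_ [_ [x xQ <-] <-]|x xQ]; first by rewrite pinvK.
  by exists (chart_inv psi x); [exists x|exact: pinvK].
have cK : compact K.
  apply: continuous_compact; last exact: compact_square.
  apply: continuous_in_subspaceT => x /set_mem /rQ[xim _].
  exact: chart_inv_continuous (mem_set xim).
have Kf : K `<=` f @^-1` chart_dom phi by move=> _ [x /rQ[_ [fx _]] <-].
have [e e0 eP] := @Lkp_norm_sup R n k p c r (eta / 2) p1 kp r0 eta20.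
exists (sobolev_nbhd f psi phi K e).
  split; last exact: sobolev_nbhd_refl.
  by apply: sobolev_subbase_open; exists f, psi, phi, K, e.
have near_w : \forall w \near z, chart_dom psi w /\ square c r (psi w).
  apply: filterI.
    by apply: open_nbhs_nbhs; split; first exact: chart_dom_open.
  by apply: (chart_map_continuous (mem_set pz)); exact: square_nbhs.
apply: filterS near_w => w [pw wr] g [Kg]; rewrite psiK => gN.
have cg := sobolev_continuous (s := g).
pose U := local_dom f psi phi `&` local_dom g psi phi.
have oU : open U by apply: openI; exact: local_dom_open.
have QU : square c (2 * r) `<=` U.
  move=> x xQ; rewrite -(pinvK x xQ).
  have Kx : K (chart_inv psi x) by exists x.
  by split; exists (chart_inv psi x) => //; split; [exact: Kpsi|exact: Kf|
    exact: Kpsi|exact: Kg].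
have cu j : {in U, continuous (fun x =>
    (local_rep g psi phi x - local_rep f psi phi x) ord0 j : R)}.
  move=> x /set_mem[xf xg].
  apply: (@continuous_comp _ _ _
    (fun x => local_rep g psi phi x - local_rep f psi phi x)
    (fun v : 'rV[R]_n => v ord0 j)); last exact: coord_continuous.
  by apply: cvgB; [exact: local_rep_continuous (mem_set xg)|
    exact: local_rep_continuous (mem_set xf)].
have sub := eP U _ oU QU cu gN (psi w) wr.
have wQ : square c (2 * r) (psi w).
  by move: wr => /squareP[w1 w2]; apply/squareP; split; lra.
have wE := chart_mapK (mem_set pw).
have Kw : K w by exists (psi w).
rewrite -(chart_mapK (mem_set (Kg w Kw))); apply: etaV; split=> // i j.
have [_ [_ [_ /(_ i j)]]] := rQ _ wQ; rewrite wE ord1 => fw.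
have repE (q : sphere -> M) : local_rep q psi phi (psi w) = phi (q w).
  by rewrite /local_rep /comp wE.
have := sub j; rewrite !mxE !repE => gw.
rewrite /ball /= in fw *.
rewrite [ltRHS](splitr eta) -(subrKA (phi (f w) ord0 j)).
by apply: le_lt_trans (ler_normD _ _) _; rewrite ltrD // distrC.
Qed.

End SobolevTopology.

(** * Matrices acting on the sphere *)

Lemma continuous_pair (T U V : topologicalType) (f : T -> U) (g : T -> V)
    (x : T) : {for x, continuous f} -> {for x, continuous g} ->
  {for x, continuous (fun y => (f y, g y))}.
Proof.
move=> cf cg W.
exact: (@cvg_pair _ _ _ _ _ _ (nbhs_filter x) _ _ _ _ cf cg).
Qed.

Lemma continuous_fst_comp (T U V : topologicalType) (f : T -> U * V) (x : T) :
  {for x, continuous f} -> {for x, continuous (fun y => (f y).1)}.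
Proof. by move=> cf; apply: continuous_comp cf _; exact: cvg_fst. Qed.

Lemma continuous_snd_comp (T U V : topologicalType) (f : T -> U * V) (x : T) :
  {for x, continuous f} -> {for x, continuous (fun y => (f y).2)}.
Proof. by move=> cf; apply: continuous_comp cf _; exact: cvg_snd. Qed.

Section ProjectiveAction.
Import Normc.
Context (R : realType).
Local Notation C := R[i].
Local Notation sphere := (sphere R).
Local Notation mat := ((C * C) * (C * C))%type.

(** Point of CP^1 with homogeneous coordinates [x]. The origin is sent to [None] by default, so that
    nonvanishing of the vector has to be carried along as a separate condition. *)
Definition to_sphere (x : C * C) : sphere :=
  if x.2 == 0 then None else Some (x.1 / x.2).

Definition homog (z : sphere) : C * C := if z is Some z then (z, 1) else (1, 0).

Lemma homogK : cancel homog to_sphere.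
Proof.
by case=> [z|]; rewrite /to_sphere /= ?oner_eq0 ?divr1 // eqxx.
Qed.

Lemma homog_neq0 z : homog z != 0.
Proof. by case: z => [z|]; rewrite xpair_eqE ?oner_eq0 ?andbF. Qed.

Lemma to_sphere_eq (x y : C * C) : x != 0 -> y != 0 -> x.1 * y.2 = x.2 * y.1 ->
  to_sphere x = to_sphere y.
Proof.
case: x y => [p q] [r s]; rewrite /to_sphere !xpair_eqE /= => x0 y0 E.
have [q0|q0] := eqVneq q 0.
  rewrite q0 eqxx andbT in x0; move: E; rewrite q0 mul0r => /eqP.
  by rewrite mulf_eq0 (negbTE x0) /= => ->.
have [s0|s0] := eqVneq s 0.
  rewrite s0 eqxx andbT in y0; move: E; rewrite s0 mulr0 => /esym/eqP.
  by rewrite mulf_eq0 (negbTE y0) (negbTE q0).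
congr Some; apply: (mulIf s0); rewrite divfK //.
by rewrite mulrAC E mulrAC divff ?mul1r.
Qed.

Lemma to_sphere_continuous_fin (x : C * C) : x.2 != 0 -> {for x, continuous to_sphere}.
Proof.
move=> x20.
have c1 : (fun y : C * C => y.1) @ x --> x.1 by exact: cvg_fst.
have c2 : (fun y : C * C => y.2) @ x --> x.2 by exact: cvg_snd.
have quo := @cvgM _ _ _ (nbhs_filter x) _ _ _ _ c1
  (@cvgV _ _ _ (nbhs_filter x) _ _ x20 c2).
have near0 : \forall y \near x, y.2 != 0.
  exact: (@cvgr_neq0 _ _ _ _ (nbhs_filter x) _ _ c2 x20).
have px : to_sphere x = Some (x.1 / x.2) by rewrite /to_sphere (negbTE x20).
rewrite /prop_for /continuous_at px => U.
rewrite -[nbhs _ U]/(\forall w \near (x.1 / x.2 : C), U (Some w)) => /quo HU.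
by apply: filterS2 near0 HU => y /negbTE y0; rewrite /to_sphere /= y0.
Qed.

(** Where the second coordinate vanishes the first does not. Exchanging the coordinates leads to the
    finite case, and the inversion, continuous at 0, undoes the exchange. *)
Lemma to_sphere_continuous (x : C * C) : x != 0 -> {for x, continuous to_sphere}.
Proof.
move=> x0; have [x20|x20] := eqVneq x.2 0; last exact: to_sphere_continuous_fin.
have x10 : x.1 != 0.
  by move: x0 x20; case: x => [p q] /=; rewrite xpair_eqE /= => x0 q0;
    rewrite q0 eqxx andbT in x0.
have swap_c : (fun y : C * C => (y.2, y.1)) @ x --> (x.2, x.1).
  by apply: continuous_pair; [exact: cvg_snd|exact: cvg_fst].
have pswap : (fun y : C * C => to_sphere (y.2, y.1)) @ x --> to_sphere (x.2, x.1).
  apply: (@continuous_comp _ _ _ (fun y : C * C => (y.2, y.1)) to_sphere) => //.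
  exact: to_sphere_continuous_fin.
have E0 : to_sphere (x.2, x.1) = Some 0 by rewrite /to_sphere /= (negbTE x10) x20 mul0r.
have inv_c : (fun y : C * C => moebius_fun 0 1 1 0 (to_sphere (y.2, y.1))) @ x -->
    moebius_fun 0 1 1 0 (to_sphere (x.2, x.1)).
  apply: (@continuous_comp _ _ _ (fun y : C * C => to_sphere (y.2, y.1))) => //.
  by rewrite E0; exact: inversion_continuous_0.
have invE (y : C * C) : y.1 != 0 ->
    moebius_fun 0 1 1 0 (to_sphere (y.2, y.1)) = to_sphere y.
  move=> y0; rewrite /to_sphere /= (negbTE y0) /= mul1r addr0 mulf_eq0 invr_eq0.
  by rewrite (negbTE y0) orbF mul0r add0r div1r invf_div.
have near0 : \forall y \near x, y.1 != 0.
  have c1 : (fun y : C * C => y.1) @ x --> x.1 by exact: cvg_fst.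
  exact: (@cvgr_neq0 _ _ _ _ (nbhs_filter x) _ _ c1 x10).
rewrite /prop_for /continuous_at -invE // => U /inv_c HU.
by apply: filterS2 near0 HU => y y0; rewrite /= invE.
Qed.

Definition mulv (m : mat) (x : C * C) : C * C :=
  (m.1.1 * x.1 + m.1.2 * x.2, m.2.1 * x.1 + m.2.2 * x.2).

Definition mact (m : mat) (z : sphere) : sphere := to_sphere (mulv m (homog z)).

Definition mdet (m : mat) : C := m.1.1 * m.2.2 - m.1.2 * m.2.1.

(** The adjugate acts as the inverse of an invertible matrix, but it is polynomial in the entries,
    so it remains continuous and nonzero at a singular nonzero limit. *)
Definition madj (m : mat) : mat := ((m.2.2, - m.1.2), (- m.2.1, m.1.1)).

Lemma moebius_fun_mact a b c d : moebius_fun a b c d = mact ((a, b), (c, d)).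
Proof.
apply/funext => -[z|]; rewrite /mact /to_sphere /=; first by rewrite !mulr1.
by rewrite !mulr1 !mulr0 !addr0.
Qed.

Lemma mdet_madj m : mdet (madj m) = mdet m.
Proof. by rewrite /mdet /=; ring. Qed.

Lemma madj_neq0 m : m != 0 -> madj m != 0.
Proof.
apply: contraNneq; case: m => [[a b] [c d]] [/= -> /eqP b0 /eqP c0 ->].
by move: b0 c0; rewrite !oppr_eq0 => /eqP -> /eqP ->.
Qed.

Lemma mulv_neq0 m x : mdet m != 0 -> x != 0 -> mulv m x != 0.
Proof.
move=> D; apply: contraNneq; case: x => [u v] [/= n0 d0].
have -> : u = 0.
  apply: (mulfI D); rewrite mulr0 /mdet.
  transitivity (m.2.2 * (m.1.1 * u + m.1.2 * v) - m.1.2 * (m.2.1 * u + m.2.2 * v)).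
    by ring.
  by rewrite n0 d0 !mulr0 subrr.
suff -> : v = 0 by [].
apply: (mulfI D); rewrite mulr0 /mdet.
transitivity (m.1.1 * (m.2.1 * u + m.2.2 * v) - m.2.1 * (m.1.1 * u + m.1.2 * v)).
  by ring.
by rewrite n0 d0 !mulr0 subrr.
Qed.

Lemma mact_moebius (m : mat) : mdet m != 0 ->
  exists g : moebius R, g = mact m :> (sphere -> sphere).
Proof.
move=> D; have gP : exists a b c d : C, a * d - b * c != 0 /\
    mact m = moebius_fun a b c d.
  exists m.1.1, m.1.2, m.2.1, m.2.2; split=> //.
  by rewrite moebius_fun_mact; case: m {D} => [[? ?] [? ?]].
by exists (Moebius gP).
Qed.

(** The product of [madj m] and [m] is a scalar matrix, so [madj m] acts as a left inverse of [g];
    bijectivity of [g] makes it a right inverse. *)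
Lemma mact_madjK (m : mat) (g : moebius R) : mdet m != 0 ->
  g = mact m :> (sphere -> sphere) -> forall z, g (mact (madj m) z) = z.
Proof.
move=> D gE z.
have adjK w : mact (madj m) (g w) = w.
  rewrite gE; case: m D {gE} => [[a b] [c d]]; rewrite /mdet /= => D.
  rewrite -!moebius_fun_mact -[LHS]/((_ \o _) w) moebius_fun_comp //; last first.
    by rewrite (_ : d * a - - b * - c = a * d - b * c) //; ring.
  rewrite (_ : d * b + - b * d = 0); last by ring.
  rewrite (_ : - c * a + a * c = 0); last by ring.
  rewrite (_ : - c * b + a * d = d * a + - b * c); last by ring.
  by rewrite moebius_fun_scalar // (_ : d * a + - b * c = a * d - b * c) //; ring.
by rewrite -{1}(moebiusVK g z) adjK moebiusVK.
Qed.

Lemma mulv_continuous (x : C * C) : continuous (mulv^~ x).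
Proof.
move=> m.
have fm : Filter (nbhs m) := nbhs_filter m.
have entry (f g : mat -> C) (u v : C) :
    {for m, continuous f} -> {for m, continuous g} ->
    {for m, continuous (fun m => f m * u + g m * v)}.
  move=> cf cg; exact: (@cvgD _ _ _ _ fm _ _ _ _
    (@cvgM _ _ _ fm _ _ _ _ cf (@cvg_cst C u mat _ fm))
    (@cvgM _ _ _ fm _ _ _ _ cg (@cvg_cst C v mat _ fm))).
have cm : {for m, continuous (id : mat -> mat)} by exact: cvg_id.
have c1 := continuous_fst_comp cm; have c2 := continuous_snd_comp cm.
apply: (@continuous_pair mat C C (fun m => m.1.1 * x.1 + m.1.2 * x.2)
  (fun m => m.2.1 * x.1 + m.2.2 * x.2)).
  exact: entry (continuous_fst_comp c1) (continuous_snd_comp c1).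
exact: entry (continuous_fst_comp c2) (continuous_snd_comp c2).
Qed.

Lemma madj_continuous : continuous madj.
Proof.
move=> m; have fm : Filter (nbhs m) := nbhs_filter m.
have opp (f : mat -> C) : {for m, continuous f} ->
    {for m, continuous (fun m => - f m)}.
  by move=> cf; exact: (@cvgN _ _ _ _ fm _ _ cf).
have cm : {for m, continuous (id : mat -> mat)} by exact: cvg_id.
have c1 := continuous_fst_comp cm; have c2 := continuous_snd_comp cm.
apply: (@continuous_pair mat (C * C)%type (C * C)%type (fun m => (m.2.2, - m.1.2))
  (fun m => (- m.2.1, m.1.1))).
  exact: continuous_pair (continuous_snd_comp c2) (opp _ (continuous_snd_comp c1)).
exact: continuous_pair (opp _ (continuous_fst_comp c2)) (continuous_fst_comp c1).
Qed.

Lemma mact_continuous (m : mat) (z : sphere) : mulv m (homog z) != 0 ->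
  {for m, continuous (mact^~ z)}.
Proof.
move=> n0; apply: (@continuous_comp _ _ _ (mulv^~ (homog z)) to_sphere).
  exact: mulv_continuous.
exact: to_sphere_continuous.
Qed.

(** Such a matrix has rank one. Its kernel is the line annihilated by a nonzero row, which gives
    [x0]; its image is spanned by a nonzero column, which gives [y]. *)
Lemma mact_singular (m : mat) : m != 0 -> mdet m = 0 ->
  exists x0 y : sphere, forall z, z <> x0 ->
    mulv m (homog z) != 0 /\ mact m z = y.
Proof.
case: m => [[a b] [c d]] m0 /eqP; rewrite /mdet subr_eq0 => /eqP /= adbc.
pose row : C * C := if (a, b) != 0 then (a, b) else (c, d).
pose col : C * C := if (a, c) != 0 then (a, c) else (b, d).
have row0 : row != 0.
  rewrite /row; case: ifPn => [//|]; rewrite negbK => /eqP[a0 b0].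
  apply/negP => /eqP[c0 d0]; move/eqP: m0; apply.
  by rewrite a0 b0 c0 d0.
have col0 : col != 0.
  rewrite /col; case: ifPn => [//|]; rewrite negbK => /eqP[a0 c0].
  apply/negP => /eqP[b0 d0]; move/eqP: m0; apply.
  by rewrite a0 b0 c0 d0.
exists (to_sphere (row.2, - row.1)), (to_sphere col) => z zx.
have reg : mulv ((a, b), (c, d)) (homog z) != 0.
  apply/eqP => -[/= ker1 ker2]; apply: zx; rewrite -[LHS]homogK.
  have rowz : row.1 * (homog z).1 + row.2 * (homog z).2 = 0.
    by rewrite /row; case: ifP.
  apply: to_sphere_eq; first exact: homog_neq0.
    move: row0; case: row {rowz} => r1 r2; rewrite !xpair_eqE /= oppr_eq0.
    by rewrite andbC.
  by rewrite /= mulrN mulrC -[LHS]add0r -rowz; ring.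
split=> //; apply: to_sphere_eq => //; rewrite /mulv /= /col.
by case: ifP => _ /=; ring: adbc.
Qed.

End ProjectiveAction.

(** * Limits of Moebius transformations *)

Section NormalizedMatrices.
Import Normc.
Context (R : realType).
Local Notation C := R[i].
Local Notation sphere := (sphere R).
Local Notation mat := ((C * C) * (C * C))%type.

Definition unit_square : set C :=
  [set z : C | `|complex.Re z| <= 1 /\ `|complex.Im z| <= 1].

Definition mat_cube : set mat :=
  (unit_square `*` unit_square) `*` (unit_square `*` unit_square).

(** Zero exactly when some entry is 1: the disjunction is encoded as one polynomial equation, so
    that it passes to limits. Its value at the zero matrix is 1. *)
Definition mat_pivot (m : mat) : C :=
  (m.1.1 - 1) * (m.1.2 - 1) * ((m.2.1 - 1) * (m.2.2 - 1)).

(* Some entry is [1] and the others have modulus at most [1]; the first condition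
   is closed and keeps the limits of such matrices away from [0]. *)
Definition normalized (m : mat) : Prop := mat_cube m /\ mat_pivot m = 0.

Lemma mat_cube_compact : compact mat_cube.
Proof. by do !apply: compact_setX; exact: square_compact. Qed.

Lemma mat_pivot_neq0 m : mat_pivot m = 0 -> m != 0.
Proof.
move=> pm; apply/eqP => m0; move: pm; rewrite m0 /mat_pivot /= => /eqP.
by rewrite !sub0r !mulrNN !mulr1 oner_eq0.
Qed.

Lemma mat_pivot_continuous : continuous mat_pivot.
Proof.
move=> m; have fm : Filter (nbhs m) := nbhs_filter m.
have cm : {for m, continuous (id : mat -> mat)} by exact: cvg_id.
have c1 := continuous_fst_comp cm; have c2 := continuous_snd_comp cm.
have sub1 (f : mat -> C) : {for m, continuous f} ->
    {for m, continuous (fun m => f m - 1)}.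
  by move=> cf; exact: (@cvgB _ _ _ _ fm _ _ _ _ cf (@cvg_cst C 1 mat _ fm)).
have mul (f g : mat -> C) : {for m, continuous f} -> {for m, continuous g} ->
    {for m, continuous (fun m => f m * g m)}.
  by move=> cf cg; exact: (@cvgM _ _ _ fm _ _ _ _ cf cg).
exact: mul
  (mul _ _ (sub1 _ (continuous_fst_comp c1)) (sub1 _ (continuous_snd_comp c1)))
  (mul _ _ (sub1 _ (continuous_fst_comp c2)) (sub1 _ (continuous_snd_comp c2))).
Qed.

Lemma max_normc (s : seq C) : s != [::] ->
  exists2 t, t \in s & forall x, x \in s -> normc x <= normc t.
Proof.
elim: s => [//|a s IH] _; have [->|/IH[t ts tmax]] := eqVneq s [::].
  by exists a; rewrite ?mem_head // => x; rewrite inE => /eqP ->.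
have [ta|/ltW ta] := leP (normc t) (normc a).
  exists a; first exact: mem_head.
  by move=> x; rewrite inE => /predU1P[->//|/tmax xt]; exact: le_trans ta.
exists t; first by rewrite inE ts orbT.
by move=> x; rewrite inE => /predU1P[->//|/tmax].
Qed.

Lemma moebius_normalized (g : moebius R) : exists m : mat,
  [/\ normalized m, mdet m != 0 & g = mact m :> (sphere -> sphere)].
Proof.
have [a [b [c [d [D gE]]]]] := moebiusP g.
have [t ts tmax] := @max_normc [:: a; b; c; d] isT.
have t0 : t != 0.
  apply: contraNneq D => t0.
  have z0 x : x \in [:: a; b; c; d] -> x = 0.
    move=> /tmax; rewrite t0 normc0 => x0; apply: eq0_normc.
    by apply/eqP; rewrite eq_le x0 /=; case: (x) => ? ?; exact: sqrtr_ge0.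
  have a0 : a = 0 by apply: z0; rewrite !inE eqxx.
  have b0 : b = 0 by apply: z0; rewrite !inE eqxx orbT.
  by rewrite a0 b0 !mul0r subr0.
have nt0 : 0 < normc t by rewrite -(ltcR 0) -normcR normr_gt0.
have unit x : x \in [:: a; b; c; d] -> unit_square (x / t).
  move=> /tmax xt; have [re im] := normc_ge_parts (x / t).
  have le1 : normc (x / t) <= 1 by rewrite normcM normcV ler_pdivrMr // mul1r.
  by split; [exact: le_trans re le1|exact: le_trans im le1].
exists ((a / t, b / t), (c / t, d / t)); split.
- split; first by split; split; apply: unit; rewrite !inE eqxx ?orbT.
  rewrite /mat_pivot /=; move: ts; rewrite !inE => /or4P[] /eqP <-;
    by rewrite divff // subrr ?(mul0r, mulr0).
- rewrite /mdet /= (_ : _ - _ = (a * d - b * c) / (t * t)); last by field.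
  by rewrite mulf_neq0 // invr_neq0 // mulf_neq0.
- rewrite gE moebius_fun_mact; apply/funext => z.
  have E : mulv ((a, b), (c, d)) (homog z) = (t * (mulv ((a / t, b / t), (c / t, d / t)) (homog z)).1,
      t * (mulv ((a / t, b / t), (c / t, d / t)) (homog z)).2).
    by rewrite /mulv /=; congr (_, _); field.
  rewrite /mact E /to_sphere /= mulf_eq0 (negbTE t0) /=; case: ifPn => // n0.
  by congr Some; rewrite -mulf_div divff // mul1r.
Qed.

(** The path z + t, or 1 / t through infinity, is continuous at t = 0 and leaves [x] as soon as t is
    nonzero. With this, a continuous map constant off one point is constant. *)
Lemma sphere_not_isolated (x : sphere) (U : set sphere) : nbhs x U ->
  exists2 w, w <> x & U w.
Proof.
pose path (y : sphere) (t : C) : C * C :=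
  if y is Some z then (z + t, 1) else (1, t).
have path0 y : path y 0 = homog y by case: y => [z|] //=; rewrite addr0.
have cpath y : {for 0, continuous (path y)}.
  have f0 : Filter (nbhs (0 : C)) := nbhs_filter _.
  have cid : {for 0, continuous (id : C -> C)} by exact: cvg_id.
  have ccst (u : C) : {for 0, continuous (fun _ : C => u)} by exact: cvg_cst.
  case: y => [z|]; last exact: continuous_pair (ccst 1) cid.
  apply: (@continuous_pair C C C (fun t => z + t) (fun=> 1)); last exact: ccst.
  exact: (@cvgD _ _ _ _ f0 _ _ _ _ (ccst z) cid).
have cpt : {for 0, continuous (to_sphere (R := R) \o path x)}.
  apply: continuous_comp => //; rewrite path0; apply: to_sphere_continuous.
  exact: homog_neq0.
have px : to_sphere (path x 0) = x by rewrite path0 homogK.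
rewrite -{1}px => /cpt /nbhs_norm0P[e /= e0 eU].
have e20 : 0 < e / 2 by rewrite divr_gt0.
exists (to_sphere (path x (e / 2))); last first.
  by apply: eU; rewrite /= gtr0_norm // ltr_pdivrMr // ltr_pMr // ltr1n.
rewrite /path /to_sphere; case: (x) => [z|] /=; last by rewrite gt_eqF.
rewrite oner_eq0 divr1 => -[/eqP]; rewrite -subr_eq0 addrC addKr.
by rewrite gt_eqF.
Qed.

Lemma sphere_open_neq (x : sphere) : open [set y | y <> x].
Proof.
have hC : hausdorff_space C by exact: norm_hausdorff.
rewrite openE => y yx; rewrite /interior.
case: x y yx => [z|] [w|] // yx; last first.
- rewrite -[nbhs _ _]/(\forall u \near w, (Some u : sphere) <> None).
  by apply: (@nearW _ _ _ (nbhs_filter w)) => u; discriminate.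
- exists [set z]; first by split; [exact: compact_set1|exact: compact_closed hC (@compact_set1 C z)].
  by move=> _ [[u /= uz <-]|-> //] [/uz].
rewrite -[nbhs _ _]/(\forall u \near w, (Some u : sphere) <> Some z).
have : open (~` [set z]) by apply: closed_openC; exact: compact_closed hC (@compact_set1 C z).
rewrite openE => /(_ w) H; apply: filterS (H _) => [u uz [] //|/= wz].
by apply: yx; rewrite wz.
Qed.

(** All three groups are pointwise stabilizers of a set of marked points, which allows a uniform
    treatment. *)
Lemma reparam_group_fixed (G : set (moebius R)) : reparam_group G ->
  exists S : set sphere, G = [set g | forall x, S x -> g x = x].
Proof.
case=> [->|[x1 ->]|[x1 [x2 [_ ->]]]].
- by exists set0; apply/seteqP; split=> // g _ x [].
- exists [set x1]; apply/seteqP; split=> [g /= gx _ -> //|g /= gx].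
  exact: gx.
- exists [set x1; x2]; apply/seteqP; split=> [g /= [g1 g2] _ [->|->] //|g /= gx].
  by split; apply: gx; [left|right].
Qed.

End NormalizedMatrices.

(** * Passing to the limit and separating orbits *)

Section Hausdorff.
Context (R : realType) (n : nat) (M : topologicalType).
Context (A : set (chart M 'rV[R]_n)) (k : nat) (p : R).
Local Notation C := R[i].
Local Notation sphere := (sphere R).
Local Notation mat := ((C * C) * (C * C))%type.
Local Notation smap := (sobolev_map A k p).

Lemma sobolev_map_ext (f g : smap) : (forall z, f z = g z) -> f = g.
Proof.
case: f g => [f cf Pf] [g cg Pg] /= fg.
have E : f = g by exact/funext.
by subst g; congr SobolevMap; exact: Prop_irrelevance.
Qed.

Definition saturation (G : set (moebius R)) (N : set smap) : set smap :=
  [set f | exists2 g, G g & N (reparam g f)].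

Lemma saturation_open G N : open N -> open (saturation G N).
Proof.
move=> oN; rewrite (_ : saturation G N =
    \bigcup_(g in G) (reparam g @^-1` N)); last first.
  by apply/seteqP; split=> f [g Gg gf]; exists g.
apply: bigcup_open => g _.
by have /continuousP := @reparam_action_continuous R n M A k p g; exact.
Qed.

(** If f o h lies in [N], so does (f o g) o (g^-1 o h), which is the same map. *)
Lemma saturation_invariant (S : set sphere) N :
  G_invariant [set g | forall x, S x -> g x = x]
    (saturation [set g | forall x, S x -> g x = x] N).
Proof.
move=> g f Gg [h Gh hf]; exists (moebius_comp (moebius_inv g) h).
  by move=> x Sx /=; rewrite Gh // -[in LHS](Gg x Sx) moebiusK.
rewrite (_ : reparam _ _ = reparam h f) //.
by apply: sobolev_map_ext => z /=; rewrite moebiusVK.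
Qed.

(** Any neighbourhoods of f1 (T m z) and f2 z share the point h2 z = h1 (T m' z), by joint
    continuity for [f1] and continuity at the fixed point [z] for [f2]; then [M] being Hausdorff
    gives equality. The map [T] is left general to cover both the matrix and its adjugate. *)
Lemma eval_limit_eq (T : mat -> mat) (m : mat)
    (f1 f2 : smap) :
  hausdorff_space M -> smooth_atlas A -> 1 <= p -> 1 < k%:R - 2 / p ->
  {for m, continuous T} ->
  (forall B N1 N2, nbhs m B -> open N1 -> N1 f1 -> open N2 -> N2 f2 ->
    exists m' h1 h2, [/\ B m', N1 h1, N2 h2 &
      forall z, h2 z = h1 (mact (T m') z)]) ->
  forall z, mulv (T m) (homog z) != 0 -> f2 z = f1 (mact (T m) z).
Proof.
move=> hM sA p1 kp cT lim z reg; apply/esym/hM => V1 V2 fV1 fV2.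
have [N1 [oN1 N1f] near1] := sobolev_eval_continuous sA p1 kp fV1.
have [N2 [oN2 N2f] /nbhs_singleton near2] := sobolev_eval_continuous sA p1 kp fV2.
have cact : {for m, continuous (fun m' => mact (T m') z)}.
  exact: (@continuous_comp mat mat sphere T (fun m' => mact m' z) m cT (mact_continuous reg)).
have [m' [h1 [h2 [/= Bm' N1h N2h hE]]]] := lim _ _ _ (cact _ near1) oN1 N1f oN2 N2f.
by exists (h2 z); split; [rewrite hE; exact: Bm'|exact: near2].
Qed.

(** The sets [rel N1 N2] generate a proper filter containing the compact cube of matrices. A cluster
    point of it is a single [m] that works for all neighbourhoods at once. *)
Lemma limit_matrix (G : set (moebius R)) (f1 f2 : smap) :
  (forall N1 N2 : set smap, open N1 -> N1 f1 -> open N2 -> N2 f2 ->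
    exists (g : moebius R) (h : smap), [/\ G g, N1 h & N2 (reparam g h)]) ->
  exists2 m : mat, m != 0 &
    forall B (N1 N2 : set smap), nbhs m B ->
      open N1 -> N1 f1 -> open N2 -> N2 f2 ->
      exists m' g h, [/\ B m', N1 h, N2 (reparam g h), G g &
        mdet m' != 0 /\ g = mact m' :> (sphere -> sphere)].
Proof.
move=> meet.
pose rel (N1 N2 : set smap) : set mat := [set m | exists g h,
  [/\ N1 h, N2 (reparam g h), G g, normalized m &
      mdet m != 0 /\ g = mact m :> (sphere -> sphere)]].
pose F : set_system mat := [set P | exists N1 N2 : set smap,
  [/\ open N1, N1 f1, open N2, N2 f2 & rel N1 N2 `<=` P]].
have relF N1 N2 : open N1 -> N1 f1 -> open N2 -> N2 f2 -> F (rel N1 N2).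
  by move=> ? ? ? ?; exists N1, N2; split.
have relN0 N1 N2 : open N1 -> N1 f1 -> open N2 -> N2 f2 -> rel N1 N2 !=set0.
  move=> oN1 N1f oN2 N2f; have [g [h [Gg N1h N2h]]] := meet N1 N2 oN1 N1f oN2 N2f.
  by have [m [nm D gE]] := moebius_normalized g; exists m, g, h.
have PF : ProperFilter F.
  apply: Build_ProperFilter; last split.
  - move=> [N1 [N2 [op1 e1 o2 e2 sP]]].
    by have [m rm] := relN0 _ _ op1 e1 o2 e2; exact: sP rm.
  - by exists setT, setT; split=> //; exact: openT.
  - move=> P Q [N1 [N2 [op1 e1 o2 e2 sP]]] [N1' [N2' [op1' e1' o2' e2' sQ]]].
    exists (N1 `&` N1'), (N2 `&` N2').
    split; [exact: openI|by []|exact: openI|by []|].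
    move=> m [g [h [[h1 h1'] [h2 h2'] Gg nm gE]]].
    by split; [apply: sP|apply: sQ]; exists g, h.
  - move=> P Q PQ [N1 [N2 [op1 e1 o2 e2 sP]]]; exists N1, N2; split=> //.
    exact: subset_trans PQ.
have Fcube : F (@mat_cube R).
  by exists setT, setT; split=> //; try exact: openT;
    move=> m [g [h [_ _ _ [cm _] _]]].
have [m [_ clm]] := @mat_cube_compact R F PF Fcube.
exists m.
  (* If the pivot were nonzero at [m], it would be nonzero nearby, where normalized matrices
     accumulate. *)
  apply: mat_pivot_neq0; apply: contrapT => /eqP pm.
  have pn : nbhs m [set m' | mat_pivot m' != 0].
    have fm : Filter (nbhs m) := nbhs_filter m.
    exact: (@cvgr_neq0 _ _ _ _ fm _ _ (@mat_pivot_continuous R m) pm).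
  have [m' [[g [h [_ _ _ [_ pm'] _]]] /=]] :=
    clm _ _ (relF setT setT openT I openT I) pn.
  by rewrite pm' eqxx.
move=> B N1 N2 mB o1 e1 o2 e2.
have [m' [[g [h [N1h N2h Gg _ gE]]] Bm']] := clm _ _ (relF _ _ o1 e1 o2 e2) mB.
by exists m', g, h.
Qed.

Lemma continuous_punctured_cst (f : smap) (x0 : sphere) (c : M) :
  hausdorff_space M -> (forall z, z <> x0 -> f z = c) -> forall z, f z = c.
Proof.
move=> hM fc z; have [->|/fc//] := pselect (z = x0).
apply: hM => V1 V2 fV1 cV2.
have [w wx V1w] := sphere_not_isolated (sobolev_continuous fV1).
by exists c; split; [rewrite -(fc w wx)|exact: nbhs_singleton].
Qed.

Lemma sobolev_map_G_hausdorff (S : set sphere) :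
  hausdorff_space M -> smooth_atlas A -> 1 <= p -> 1 < k%:R - 2 / p ->
  G_hausdorff A k p [set g | forall x, S x -> g x = x].
Proof.
move=> hM sA p1 kp f1 f2 norbit.
set G := [set g | _] in norbit *.
apply: contrapT => nsep; apply: norbit.
have [i1 iE] : exists i : moebius R, i = id :> (sphere -> sphere).
  have [i iE] := @mact_moebius R ((1, 0), (0, 1))
    ltac:(by rewrite /mdet /= !mulr1 mulr0 subr0 oner_neq0).
  exists i; rewrite iE -moebius_fun_mact; apply/funext => z.
  exact: moebius_fun_scalar (oner_neq0 _) z.
have Gi : G i1 by move=> x _; rewrite iE.
have reparam1 (f : smap) : reparam i1 f = f.
  by apply: sobolev_map_ext => z /=; rewrite iE.
have sat (N : set smap) f : N f -> saturation G N f.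
  by move=> Nf; exists i1; rewrite ?reparam1.
have meet (N1 N2 : set smap) : open N1 -> N1 f1 -> open N2 -> N2 f2 ->
    exists (g : moebius R) (h : smap), [/\ G g, N1 h & N2 (reparam g h)].
  move=> o1 e1 o2 e2; apply: contrapT => nmeet; apply: nsep.
  exists (saturation G N1), (saturation G N2); split; split.
  - exact: saturation_open.
  - exact: saturation_open.
  - exact: saturation_invariant.
  - exact: saturation_invariant.
  - exact: sat.
  - exact: sat.
  - apply/seteqP; split=> // f [[g Gg gf] [h Gh hf]]; apply: nmeet.
    (* A map [f] in both saturations has f o g in [N1] and f o h in [N2], and the second is the
       first followed by the reparametrization g^-1 o h. *)
    exists (moebius_comp (moebius_inv g) h), (reparam g f); split=> //.
      by move=> x Sx /=; rewrite Gh // -[in LHS](Gg x Sx) moebiusK.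
    rewrite (_ : reparam _ _ = reparam h f) //.
    by apply: sobolev_map_ext => z /=; rewrite moebiusVK.
have [m m0 mlim] := limit_matrix meet.
have E2 : forall z, mulv m (homog z) != 0 -> f2 z = f1 (mact m z).
  apply: (@eval_limit_eq id) => // B N1 N2 mB o1 e1 o2 e2.
  have [m' [g [h [Bm' N1h N2h Gg [D gE]]]]] := mlim B N1 N2 mB o1 e1 o2 e2.
  by exists m', h, (reparam g h); split=> // z /=; rewrite gE.
(* The roles of the two maps are exchanged: [h] is recovered from [reparam g h] by composing with
   the adjugate action. *)
have E1 : forall z, mulv (madj m) (homog z) != 0 -> f1 z = f2 (mact (madj m) z).
  apply: (@eval_limit_eq (@madj R)) => //.
    exact: madj_continuous.
  move=> B N2 N1 mB o2 e2 o1 e1.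
  have [m' [g [h [Bm' N1h N2h Gg [D gE]]]]] := mlim B N1 N2 mB o1 e1 o2 e2.
  exists m', (reparam g h), h; split=> // z.
  by rewrite /= (mact_madjK D gE).
have [D|D] := eqVneq (mdet m) 0.
  have [x0 [y rk]] := mact_singular m0 D.
  have [x0' [y' rk']] := mact_singular (madj_neq0 m0) (etrans (mdet_madj m) D).
  have f2c : forall z, f2 z = f1 y.
    apply: (@continuous_punctured_cst _ x0) => // z /rk[reg <-]; exact: E2.
  have f1c : forall z, f1 z = f2 y'.
    apply: (@continuous_punctured_cst _ x0') => // z /rk'[reg <-]; exact: E1.
  (* The chain f1 z = f2 y' = f1 y = f2 z identifies the two constants; the identity lies in [G] for
     every set of marked points. *)
  exists i1 => //; rewrite reparam1.
  by apply: sobolev_map_ext => z; rewrite f1c !f2c.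
have [g gE] := mact_moebius D.
exists g; last first.
  apply: sobolev_map_ext => z /=; rewrite gE; apply: E2.
  by apply: mulv_neq0 => //; exact: homog_neq0.
(* It remains to see that the limit fixes the marked points. If [m] moved [x], so would all matrices
   near [m], but some of these act as elements of [G]. *)
move=> x Sx; rewrite gE; apply: contrapT => gx.
have reg : mulv m (homog x) != 0 by apply: mulv_neq0 => //; exact: homog_neq0.
have mB : nbhs m [set m' | mact m' x <> x].
  have nx : nbhs (mact m x) [set y | y <> x].
    by apply: open_nbhs_nbhs; split; [exact: sphere_open_neq|].
  exact: (mact_continuous reg nx).
have [m' [g' [h [Bm' _ _ Gg [_ g'E]]]]] :=
  mlim _ _ _ mB openT I openT I.
by apply: Bm'; rewrite -g'E; exact: Gg.
Qed.

End Hausdorff.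

Theorem corollary3p2 (R : realType) (n : nat) (M : topologicalType)
    (A : set (chart M 'rV[R]_n)) (metric : riemannian_metric A)
    (k : nat) (p : R) (G : set (moebius R)) :
  smooth_manifold A -> compact [set: M] ->
  1 <= p -> 1 < k%:R - 2 / p ->
  reparam_group G ->
  G_hausdorff A k p G.
Proof.
move=> [hM _ sA] _ p1 kp /reparam_group_fixed[S ->].
exact: sobolev_map_G_hausdorff.
Qed.
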